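(* Let $\Omega\subset\mathbb{R}^N$ be a bounded $C^{1,1}$ domain, let $a\in(\frac12,1)$, $T>0$, and let $q\in C_c^\infty(\Omega)$ be such that zero is not an eigenvalue of the parabolic problem with potential $q$ (in the sense given in the context). For $f\in C_c^\infty(\Omega)$ let $u_f\in L^2((0,T)\times\Omega)$ be the solution of $$\begin{cases}\partial_t u_f+(-\Delta)^a u_f+q u_f=0 & \text{in }(0,T)\times\Omega,\\ u_f=0 & \text{in }(0,T)\times(\mathbb{R}^N\setminus\Omega),\\ u_f(0,\cdot)=f & \text{in }\Omega.\end{cases}$$ Then, for every fixed time $\tilde T$ with $0<\tilde T\le T$, the set $\{u_f(\tilde T,\cdot): f\in C_c^\infty(\Omega)\}$ is dense in $L^2(\Omega)$.
   Context: The fractional Laplacian is $(-\Delta)^a u=\mathcal F^{-1}\{|\xi|^{2a}\hat u(\xi)\}$, equivalently $(-\Delta)^a u(x)=C_{N,a}\,\mathrm{p.v.}\int_{\mathbb{R}^N}\frac{u(x)-u(y)}{|x-y|^{N+2a}}\,dy$ with the usual normalizing constant $C_{N,a}$. Let $d(x)=\inf_{y\in\partial\Omega}\|x-y\|_2$ and let $L^1(\Omega,d^a)$ be the space of $f$ with $f d^a$ integrable on $\Omega$. Zero is not an eigenvalue of the parabolic problem with potential $q$: if $u_0\in L^1((0,T);L^1(\Omega,d^a))$ satisfies the displayed problem with $f\equiv0$, or satisfies the singular boundary data problem $\partial_t u+(-\Delta)^a u+qu=0$ in $(0,T)\times\Omega$, $u=0$ in $(0,T)\times(\mathbb{R}^N\setminus\overline\Omega)$,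 $\lim_{x\to y\in\partial\Omega} u/d^{a-1}=0$ on $(0,T)\times\partial\Omega$, $u(0,\cdot)=0$, then $u_0\equiv0$. This guarantees uniqueness of solutions. The solution is $u_f(t,x)=\sum_{n}e^{-t\lambda_n}\phi_n(x)\langle\phi_n,f\rangle_{L^2(\Omega)}$, where $\lambda_n$ and $\phi_n$ are the eigenvalues and $L^2$-normalized eigenfunctions of $((-\Delta)^a+q)\phi_n=\lambda_n\phi_n$ in $\Omega$, $\phi_n=0$ in $\mathbb{R}^N\setminus\Omega$; it is continuous in time with values in $L^2(\Omega)$. *)

(* Defs.v *)
From HB Require Import structures.
From mathcomp Require Import all_boot all_order all_algebra.
From mathcomp Require Import all_classical all_reals all_analysis.

Set Implicit Arguments.
Unset Strict Implicit.
Unset Printing Implicit Defensive.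

Import Order.TTheory GRing.Theory Num.Theory.
Import numFieldNormedType.Exports.

Local Open Scope classical_set_scope.
Local Open Scope ring_scope.

(** * Lebesgue measure on row vectors *)

Definition rV_display : measure_display.
Proof. exact: default_measure_display. Qed.

(** The product sigma-algebra, generated by the coordinates (as the library
    does for [n.-tuple]). *)
Section rV_measurable.
Variables (R : realType) (n : nat).

Definition rV_coord (i : 'I_n) (x : 'rV[R]_n) : measurableTypeR R := x ord0 i.

Let rV_measurable0 : g_sigma_preimage rV_coord set0.
Proof. exact: sigma_algebra0. Qed.

Let rV_measurableC A :
  g_sigma_preimage rV_coord A -> g_sigma_preimage rV_coord (~` A).
Proof. exact: sigma_algebraC. Qed.

Let rV_measurable_bigcup (F : (set 'rV[R]_n)^nat) :
  (forall i, g_sigma_preimage rV_coord (F i)) ->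
  g_sigma_preimage rV_coord (\bigcup_i F i).
Proof. exact: sigma_algebra_bigcup. Qed.

HB.instance Definition _ := @isMeasurable.Build rV_display 'rV[R]_n
  (g_sigma_preimage rV_coord) rV_measurable0 rV_measurableC rV_measurable_bigcup.

Lemma measurable_rV_coord (i : 'I_n) : measurable_fun [set: 'rV[R]_n] (rV_coord i).
Proof.
move=> _ Y mY; rewrite setTI; apply: sub_sigma_algebra => /=.
rewrite -bigcup_seq/=; exists i => /=; first by rewrite mem_index_enum.
by exists Y => //; rewrite setTI.
Qed.

Lemma measurable_fun_rVP d (T : measurableType d) (f : T -> 'rV[R]_n) :
  (forall i, measurable_fun [set: T] (rV_coord i \o f)) ->
  measurable_fun [set: T] f.
Proof.
move=> mf _ A; rewrite setTI.
suff : @measurable _ 'rV[R]_n `<=` [set B | measurable (f @^-1` B)] by apply.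
apply: smallest_sub; first split => /=.
- by rewrite preimage_set0.
- by move=> B mB; rewrite setTD preimage_setC; exact: measurableC.
- by move=> F mF; rewrite preimage_bigcup; exact: bigcup_measurable.
- rewrite -bigcup_seq; apply: bigcup_sub => i _ _ [B mB <-] /=.
  by have := mf i measurableT B mB; rewrite !setTI.
Qed.

End rV_measurable.

Section leb_step.
Variables (R : realType) (n : nat).

Definition rV_cons (p : measurableTypeR R * 'rV[R]_n) : 'rV[R]_n.+1 :=
  \row_i oapp (p.2 ord0) p.1 (unlift ord0 i).

Definition rV_uncons (x : 'rV[R]_n.+1) : measurableTypeR R * 'rV[R]_n :=
  (x ord0 ord0, \row_j x ord0 (lift ord0 j)).

Lemma rV_consK : cancel rV_cons rV_uncons.
Proof.
move=> [t y]; rewrite /rV_cons /rV_uncons; congr pair.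
  by rewrite mxE unlift_none.
by apply/rowP => j; rewrite !mxE liftK.
Qed.

Lemma rV_unconsK : cancel rV_uncons rV_cons.
Proof.
move=> x; apply/rowP => i; rewrite mxE.
by case: unliftP => [j ->|->] /=; rewrite ?mxE.
Qed.

Lemma measurable_rV_cons : measurable_fun setT rV_cons.
Proof.
apply: measurable_fun_rVP => i; case: (unliftP ord0 i) => [j ->|->].
- rewrite (_ : _ \o _ = rV_coord j \o snd).
    exact: measurableT_comp (measurable_rV_coord j) measurable_snd.
  by apply/funext => p /=; rewrite /rV_coord mxE liftK.
- rewrite (_ : _ \o _ = fst); first exact: measurable_fst.
  by apply/funext => p /=; rewrite /rV_coord mxE unlift_none.
Qed.

Lemma measurable_rV_uncons : measurable_fun setT rV_uncons.
Proof.
apply/measurable_fun_pairP; split.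
- exact: (measurable_rV_coord ord0).
- apply: measurable_fun_rVP => j.
  rewrite (_ : _ \o _ = rV_coord (lift ord0 j)); first exact: measurable_rV_coord.
  by apply/funext => x /=; rewrite /rV_coord mxE.
Qed.

Variable m : {sigma_finite_measure set 'rV[R]_n -> \bar R}.

Definition leb_step : set 'rV[R]_n.+1 -> \bar R :=
  pushforward (lebesgue_measure \x m)%E rV_cons.

HB.instance Definition _ := Measure.copy leb_step
  (measure_function_pushforward__canonical__measure_function_Measure
     (lebesgue_measure \x m)%E measurable_rV_cons).

Let leb_step_sigma_finite : sigma_finite setT leb_step.
Proof.
have [F FT Foo] :=
  lebesgue_integral_fubini.product_measure_sigma_finite_subproof (@lebesgue_measure R) m.
exists (fun k => rV_uncons @^-1` F k).
  by rewrite -preimage_bigcup -FT preimage_setT.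
move=> k; have [mF Fk] := Foo k; split.
  by rewrite -[X in measurable X]setTI; exact: measurable_rV_uncons.
rewrite /leb_step /pushforward -comp_preimage.
by rewrite (_ : _ \o _ = id) //; apply/funext => p /=; rewrite rV_consK.
Qed.

HB.instance Definition _ := Measure_isSigmaFinite.Build _ _ _
  leb_step leb_step_sigma_finite.

End leb_step.

Fixpoint leb (R : realType) (n : nat) : {sigma_finite_measure set 'rV[R]_n -> \bar R} :=
  match n with
  | 0 => \d_(0 : 'rV[R]_0)
  | k.+1 => leb_step (leb R k)
  end.

Local Notation stleb R n := (@lebesgue_measure R \x leb R n)%E.

Section geometry.
Variables (R : realType).

(** The topology of ['rV[R]_n] is that of the sup norm; metric quantities are
    Euclidean. *)
Definition dot n (x y : 'rV[R]_n) : R := \sum_i x ord0 i * y ord0 i.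

Definition enorm n (x : 'rV[R]_n) : R := Num.sqrt (dot x x).

Definition frontier n (Omega : set 'rV[R]_n) : set 'rV[R]_n :=
  closure Omega `\` interior Omega.

Definition bdist n (Omega : set 'rV[R]_n) (x : 'rV[R]_n) : R :=
  inf [set enorm (x - y) | y in frontier Omega].

(** [G] is the gradient of [g]; being Lipschitz, it is continuous, so [g] is
    of class C^1. *)
Definition C11_function k (g : 'rV[R]_k -> R) :=
  exists (G : 'rV[R]_k -> 'rV[R]_k) (L : R),
    (forall z v, is_derive z v g (dot (G z) v)) /\
    (forall z w, enorm (G z - G w) <= L * enorm (z - w)).

(** Near each boundary point, in an orthonormal frame given by [U], the set is
    the strict epigraph of a C^{1,1} function of the last [n] coordinates. *)
Definition C11_boundary n (Omega : set 'rV[R]_n.+1) :=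
  forall y, frontier Omega y ->
    exists (U : 'M[R]_n.+1) (r : R) (g : 'rV[R]_n -> R),
      [/\ U *m U^T = 1%:M, 0 < r, C11_function g &
        forall x, enorm (x - y) < r ->
          let z := (x - y) *m U in
          Omega x <-> g (col' ord0 z) < z ord0 ord0].

Definition bounded_C11_domain n (Omega : set 'rV[R]_n.+1) :=
  [/\ open Omega, connected Omega, Omega !=set0, bounded_set Omega &
      C11_boundary Omega].

End geometry.

Section smooth.
Variables (R : realType) (V : normedModType R).

Fixpoint iter_derive (vs : seq V) (f : V -> R) : V -> R :=
  if vs is v :: vs' then fun x => 'D_v (iter_derive vs' f) x else f.

(** For an open subset [A] of a finite-dimensional [V] this is C^infty(A). *)
Definition smooth_on (A : set V) (f : V -> R) :=
  forall vs x, A x ->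
    {for x, continuous (iter_derive vs f)} /\
    forall v, derivable (iter_derive vs f) x v.

Definition Cc_infty (A : set V) : set (V -> R) :=
  [set f | [/\ smooth_on setT f, compact (closure [set x | f x != 0]) &
               closure [set x | f x != 0] `<=` A]].

End smooth.

Section L2.
Variables (R : realType) (n : nat) (Omega : set 'rV[R]_n).

Definition L2norm (g : 'rV[R]_n -> R) : \bar R :=
  'N[leb R n]_2%:E[EFin \o (g \_ Omega)].

Definition L2 : set ('rV[R]_n -> R) :=
  [set g | measurable_fun Omega g /\ (L2norm g < +oo)%E].

Definition dense_in_L2 (S : set ('rV[R]_n -> R)) :=
  S `<=` L2 /\
  forall g, L2 g -> forall eps : R, 0 < eps ->
    exists2 h, S h & (L2norm (h \- g)%R < eps%:E)%E.

End L2.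

Section fractional_laplacian.
Variables (R : realType) (n : nat) (a : R).
Local Notation rV := 'rV[R]_n.+1.
Local Notation leb2 := (leb R n.+1 \x leb R n.+1)%E.

Definition frac_kernel (x y : rV) : R := (enorm (x - y) `^ (n.+1%:R + 2 * a))^-1.

(** C_{N,a}, given by 1/C_{N,a} = int (1 - cos z_1) / |z|^(N+2a) dz, which is the
    value for which the Fourier multiplier is |xi|^(2a). *)
Definition frac_const : R :=
  (\int[leb R n.+1]_z ((1 - cos (z ord0 ord0)) * frac_kernel z 0))^-1.

Definition frac_lap (u : rV -> R) (x : rV) : R :=
  lim ((frac_const * \int[leb R n.+1]_(y in [set y | e < enorm (x - y)])
          ((u x - u y) * frac_kernel x y)) @[e --> 0^'+]).

Definition gagliardo (u : rV -> R) : \bar R :=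
  \int[leb2]_p ((u p.1 - u p.2) ^+ 2 * frac_kernel p.1 p.2)%:E.

(** The symmetric bilinear form of [frac_lap]: it equals the integral of
    [frac_lap u] times [v] for smooth compactly supported [u] and [v]. *)
Definition frac_form (u v : rV -> R) : R :=
  frac_const / 2 * \int[leb2]_p
    ((u p.1 - u p.2) * (v p.1 - v p.2) * frac_kernel p.1 p.2).

(** Functions in H^a(R^N) vanishing outside [Omega]. *)
Definition energy_space (Omega : set rV) : set (rV -> R) :=
  [set v : rV -> R | [/\ measurable_fun setT v, forall x, ~ Omega x -> v x = 0,
               (L2norm Omega v < +oo)%E & (gagliardo v < +oo)%E]].

End fractional_laplacian.

Section parabolic_problem.
Variables (R : realType) (n : nat) (Omega : set 'rV[R]_n.+1) (a T : R).
Variable q : 'rV[R]_n.+1 -> R.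
Local Notation rV := 'rV[R]_n.+1.
Local Notation Q := (`]0, T[%classic `*` Omega).
Implicit Types (u : R -> rV -> R) (phi : R * rV -> R).

(** Weak solution of  u_t + (-Delta)^a u + q u = 0  in (0,T) x Omega,  u = 0
    outside Omega,  u(0) = f,  in the class C([0,T]; L^2) with
    L^2((0,T); H^a) energy. The equation is tested against the functions of
    the energy space and integrated in time over (0,t). *)
Definition weak_solution (f : rV -> R) u :=
  [/\ measurable_fun (`]0, T[%classic `*` [set: rV]) (fun p => u p.1 p.2) /\
      (\int[stleb R n.+1]_(p in Q) (u p.1 p.2 ^+ 2)%:E < +oo)%E,
      (forall t x, 0 < t < T -> ~ Omega x -> u t x = 0) /\
      {ae leb R n.+1, forall x, Omega x -> u 0 x = f x},
      (forall t, 0 <= t <= T -> L2 Omega (u t) /\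
        L2norm Omega (u s \- u t) @[s --> within `[0, T]%classic (nbhs t)]
          --> 0%E),
      {ae @lebesgue_measure R, forall t, 0 < t < T ->
        energy_space a Omega (u t)} /\
      (\int[@lebesgue_measure R]_(t in `]0%R, T[%classic) gagliardo a (u t) < +oo)%E &
      forall v, energy_space a Omega v -> forall t, 0 <= t <= T ->
        \int[leb R n.+1]_(x in Omega) (u t x * v x) +
        \int[@lebesgue_measure R]_(s in `]0, t[)
          (frac_form a (u s) v + \int[leb R n.+1]_(x in Omega) (q x * u s x * v x))
        = \int[leb R n.+1]_(x in Omega) (f x * v x)].

Definition weighted_L1 : set (R -> rV -> R) :=
  [set u | (stleb R n.+1).-integrable Q
             (fun p => (u p.1 p.2 * bdist Omega p.2 `^ a)%:E)].

Definition space_frac_lap phi (p : R * rV) : R :=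
  frac_lap a (fun x => phi (p.1, x)) p.2.

Definition adjoint_op phi (p : R * rV) : R :=
  - 'D_(1, 0) phi p + space_frac_lap phi p + q p.2 * phi p.

(** Test functions for solutions that are merely in [weighted_L1]: they behave
    like d^a up to the boundary, so that the pairing is finite and a singular
    profile d^(a-1) at the boundary is detected; functions with compact support in
    Omega would not see it. *)
Definition boundary_test phi :=
  [/\ smooth_on Q phi,
      {within `[0, T]%classic `*` Omega, continuous phi},
      (forall t x, ~ Omega x -> phi (t, x) = 0),
      (forall x, phi (T, x) = 0) &
      exists K : R, forall p, Q p ->
        [/\ `|phi p| <= K * bdist Omega p.2 `^ a,
            `|'D_(1, 0) phi p| <= K * bdist Omega p.2 `^ a &
            `|space_frac_lap phi p| <= K * bdist Omega p.2 `^ a]].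

Definition very_weak_solution (f : rV -> R) u :=
  (forall t x, 0 < t < T -> ~ Omega x -> u t x = 0) /\
  forall phi, boundary_test phi ->
    \int[stleb R n.+1]_(p in Q) (u p.1 p.2 * adjoint_op phi p) =
    \int[leb R n.+1]_(x in Omega) (f x * phi (0, x)).

(** The equation holds in the sense of distributions in (0,T) x Omega. The
    boundary limit is taken jointly in (t,x): a limit in x for each fixed t
    would not see boundary mass concentrated at a single time. For the same
    reason the initial value is attained in L^1(Omega, d^a), up to the
    boundary. *)
Definition singular_solution0 u :=
  [/\ (forall phi, Cc_infty Q phi ->
        \int[stleb R n.+1]_(p in Q) (u p.1 p.2 * adjoint_op phi p) = 0),
      (forall t x, 0 < t < T -> ~ closure Omega x -> u t x = 0),
      (forall t y, 0 < t < T -> frontier Omega y ->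
        (u p.1 p.2 / bdist Omega p.2 `^ (a - 1))
          @[p --> within ([set: R] `*` Omega) (nbhs (t, y))] --> (0 : R)) &
      (\int[leb R n.+1]_(x in Omega) (`|u t x| * bdist Omega x `^ a)%:E)%E
        @[t --> 0^'+] --> 0%E].

Definition zero_not_eigenvalue :=
  forall u0, weighted_L1 u0 ->
    very_weak_solution (cst 0) u0 \/ singular_solution0 u0 ->
    {ae stleb R n.+1, forall p, Q p -> u0 p.1 p.2 = 0}.

End parabolic_problem.

(* Main.v *)
Require Import Defs.
From HB Require Import structures.
From mathcomp Require Import all_boot all_order all_algebra.
From mathcomp Require Import all_classical all_reals all_analysis.
From mathcomp Require Import measurable_realfun ring lra.

Set Implicit Arguments.
Unset Strict Implicit.
Unset Printing Implicit Defensive.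

Import Order.TTheory GRing.Theory Num.Theory.
Import numFieldNormedType.Exports.

Local Open Scope classical_set_scope.
Local Open Scope ring_scope.

(** Let (_, _) be the scalar product of L^2(Omega), D the set of test functions
    and S_t f the solution at time t with initial value f. The range of S_t is
    dense because S is a symmetric semigroup that is strongly continuous at 0;
    all three properties are read off the weak formulation.

    Symmetric semigroup. Let u and w be the solutions with initial values f
    and g, and F(s, t) = (u s, w t). Almost every [w t] may serve as a test
    function in the equation for u, so that F(0, t) - F(s, t) is the integral of
    B(u r, w t) over r in (0, s), where B is the symmetric bilinear form of the
    operator; the same holds with u and w exchanged. The kernel B(u s, w t) is
    integrable in (s, t), being a combination of Gram kernels of functions that
    are square integrable in time and space, so Fubini's theorem applies, and it
    says that the one-form F (ds + dt) is closed. Hence F(s, t) depends on s + t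
    only ([function_of_sum]), which means (S_s f, S_t g) = (S_(s+t) f, g) and
    (S_t f, g) = (f, S_t g) ([weak_solution_semigroup],
    [weak_solution_symmetric]).

    Bound. When u = w and |q| <= M, the kernel B(u s, u t) + M (u s, u t) is a
    sum of Gram kernels, so its integral over a square is nonnegative
    ([form_energy]). Together with the convexity of t |-> (u t, u 0), this gives
    |S_t f|^2 <= 2 |f|^2 for small t ([weak_solution_short_time]); doubling the
    time extends such bounds to all t.

    Density ([dense_range_semigroup]). Let f be in D and let r be the residual
    of the best approximation of S_(t/2) f in the closure of the range of S_t.
    Then r is orthogonal to this range, so |S_(t/2) r|^2 = (S_t r, r) = 0 and
    |r|^2 = (r, S_(t/2) f) = (S_(t/2) r, f) = 0. Thus the closure of the range of
    S_t contains the range of S_(t/2), hence that of S_(t/4), and so on; it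
    contains S_(t/2^k) f, which tends to f, and D is dense in L^2(Omega)
    ([Cc_infty_dense_square]). As S_t is given on D only, the argument
    runs with almost-minimisers and approximations of r in D. *)

(** * Dense range of a symmetric semigroup *)

(** The discriminant inequality, in the form in which an almost-minimiser of
    a quadratic functional is almost orthogonal to every direction. *)
Lemma discriminant (R : realFieldType) (p b e : R) : 0 <= p -> 0 <= e ->
  (forall c, 0 <= e + 2 * c * b + c ^+ 2 * p) -> b ^+ 2 <= e * p.
Proof.
move=> p0 e0 h; have [pp|] := ltP 0 p; last first.
  move=> pl; have p00 : p = 0 by lra.
  rewrite p00 mulr0.
  have [->|b0] := eqVneq b 0; first by rewrite expr0n.
  have := h (- (e + 1) / (2 * b)).
  have -> : 2 * (- (e + 1) / (2 * b)) * b = - (e + 1) by field.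
  by rewrite p00 mulr0; lra.
have := h (- b / p).
have -> : e + 2 * (- b / p) * b + (- b / p) ^+ 2 * p = (e * p - b ^+ 2) / p.
  by field; rewrite gt_eqF.
by rewrite pmulr_lge0 ?invr_gt0// subr_ge0.
Qed.

Section abstract_density.
Variables (R : realType) (V : lmodType R) (H D : set V) (ip : V -> V -> R).
Hypotheses (DH : D `<=` H)
  (HL : forall c x y, H x -> H y -> H (c *: x + y))
  (DL : forall c x y, D x -> D y -> D (c *: x + y))
  (D0 : D 0)
  (ipC : forall x y, H x -> H y -> ip x y = ip y x)
  (ipL : forall c x y z, H x -> H y -> H z -> ip (c *: x + y) z = c * ip x z + ip y z)
  (ip_ge0 : forall x, H x -> 0 <= ip x x)
  (D_dense : forall g, H g -> forall e, 0 < e -> exists2 x, D x & ip (x - g) (x - g) < e).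

Local Notation nsq x := (ip x x).

Let H0 : H 0. Proof. exact: DH. Qed.

Let HZ c x : H x -> H (c *: x).
Proof. by move=> Hx; rewrite -[_ *: _]addr0; apply: HL. Qed.

Let HD x y : H x -> H y -> H (x + y).
Proof. by move=> Hx Hy; rewrite -[x]scale1r; apply: HL. Qed.

Let HB x y : H x -> H y -> H (x - y).
Proof. by move=> Hx Hy; rewrite addrC -scaleN1r; apply: HL. Qed.

Let ipZl c x z : H x -> H z -> ip (c *: x) z = c * ip x z.
Proof.
move=> Hx Hz; have := @ipL 1 0 0 z H0 H0 Hz.
rewrite scale1r addr0 mul1r => h; have {}h : ip 0 z = 0 by lra.
by rewrite -[c *: x]addr0 ipL// h addr0.
Qed.

Let ipDl x y z : H x -> H y -> H z -> ip (x + y) z = ip x z + ip y z.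
Proof. by move=> Hx Hy Hz; rewrite -{1}[x]scale1r ipL// mul1r. Qed.

Let ipBl x y z : H x -> H y -> H z -> ip (x - y) z = ip x z - ip y z.
Proof.
by move=> Hx Hy Hz; rewrite addrC -scaleN1r ipL// mulN1r addrC.
Qed.

Let ipBr x y z : H x -> H y -> H z -> ip z (x - y) = ip z x - ip z y.
Proof. by move=> Hx Hy Hz; rewrite !(ipC Hz)//; [exact: ipBl|exact: HB]. Qed.

Let nsqDZ c x y : H x -> H y ->
  nsq (x + c *: y) = nsq x + 2 * c * ip x y + c ^+ 2 * nsq y.
Proof.
move=> Hx Hy; have Hcy := HZ c Hy; have Hs := HD Hx Hcy.
rewrite ipDl// (ipC Hx Hs) (ipC Hcy Hs) !ipDl// !ipZl// (ipC Hy Hx).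
by rewrite (ipC Hx Hcy) (ipC Hy Hcy) !ipZl// (ipC Hy Hx); ring.
Qed.

Let cauchy_schwarz x y : H x -> H y -> ip x y ^+ 2 <= nsq x * nsq y.
Proof.
move=> Hx Hy; apply: discriminant => [||c]; rewrite ?ip_ge0//.
by rewrite -nsqDZ//; apply: ip_ge0; apply: HD => //; apply: HZ.
Qed.

Let nsqD_le x y : H x -> H y -> nsq (x + y) <= 2 * nsq x + 2 * nsq y.
Proof.
move=> Hx Hy; have := nsqDZ 1 Hx Hy; have := nsqDZ (- 1) Hx Hy.
have : 0 <= nsq (x + (- 1) *: y) by apply: ip_ge0; apply: HD => //; apply: HZ.
by rewrite scale1r; lra.
Qed.

Let nsqN x y : H x -> H y -> nsq (x - y) = nsq (y - x).
Proof.
move=> Hx Hy; rewrite -(opprB y x) -(scaleN1r (y - x)).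
have Hyx := HB Hy Hx; have Hm := HZ (- 1) Hyx.
by rewrite ipZl// (ipC Hyx Hm) ipZl//; ring.
Qed.

Let le_sqr (x y : R) : 0 <= y -> x ^+ 2 <= y ^+ 2 -> x <= y.
Proof.
move=> y0 h; have [/ltW x0|x0] := ltP x 0; first exact: le_trans x0 y0.
by rewrite -(@ler_pXn2r _ 2).
Qed.

Let orthogonal_dense w : H w -> (forall z, D z -> ip w z = 0) -> nsq w = 0.
Proof.
move=> Hw w0; apply/eqP; rewrite eq_le ip_ge0// andbT leNgt; apply/negP => w1.
have [z Dz zw] := D_dense Hw w1.
have Hz := DH Dz; have Hzw := HB Hz Hw.
have := cauchy_schwarz Hzw Hw; rewrite ipBl// (ipC Hz)// w0// sub0r.
by nra.
Qed.

Section range_square.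
Variables (P S : V -> V) (C : R).
Hypotheses (PH : forall x, D x -> H (P x)) (SH : forall x, D x -> H (S x))
  (PS : forall x y, D x -> D y -> ip (S x) (S y) = ip (P x) y)
  (PC : forall x y, D x -> D y -> ip (P x) y = ip x (P y))
  (SC : forall x y, D x -> D y -> ip (S x) y = ip x (S y))
  (C0 : 0 <= C) (Pb : forall x, D x -> nsq (P x) <= C * nsq x).

(** The pairing of [P z] with a vector of [D] is linear in [z] by symmetry, and
    [D] is dense; hence [P] is linear up to vectors of norm 0. *)
Let P_linear c x y : D x -> D y -> nsq (P (c *: x + y) - (c *: P x + P y)) = 0.
Proof.
move=> Dx Dy; have Dz := DL c Dx Dy.
have Hl : H (c *: P x + P y) by apply: HL; apply: PH.
apply: orthogonal_dense => [|z Dz']; first by apply: HB; [exact: PH|].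
rewrite ipBl//; [|exact: PH|exact: DH].
rewrite ipL//; [|exact: PH|exact: PH|exact: DH].
by rewrite !PC// ipL//; [rewrite subrr|exact: DH|exact: DH|exact: PH].
Qed.

Let nsq_null x y : H x -> H y -> nsq (x - y) = 0 -> nsq x = nsq y.
Proof.
move=> Hx Hy xy; have Hxy := HB Hx Hy.
have := cauchy_schwarz Hxy Hy; rewrite xy mul0r => h.
have i0 : ip y (x - y) = 0.
  by rewrite ipC//; apply/eqP; rewrite -sqrf_eq0 eq_le h sqr_ge0.
have := nsqDZ 1 Hy Hxy; rewrite scale1r [y + _]addrC subrK => ->.
by rewrite i0 xy; ring.
Qed.

(** [P] plays the role of S_t and [S] that of its square root S_(t/2). If [r]
    is the residual of a best approximation of [S f] by the range of [P], then [r]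
    is orthogonal to this range, so the squared norm of [S r], which is the
    product of [P r] with [r], vanishes, and that of [r], which is the product
    of [r] with [S f], that is, of [S r] with [f], vanishes too. Here [r] is
    the residual of an almost-minimiser, and [r'] replaces it where [P] or [S]
    has to be applied. *)
Lemma range_sqrt_sub_closure_range f : D f -> forall e, 0 < e ->
  exists2 x, D x & nsq (P x - S f) < e.
Proof.
move=> Df.
pose d : set R := [set nsq (P x - S f) | x in D].
have Hf := SH Df.
have Hr x : D x -> H (P x - S f) by move=> Dx; apply: HB => //; apply: PH.
have hi : has_inf d.
  split; first by exists (nsq (P 0 - S f)), 0.
  by exists 0 => _ [x Dx <-]; apply/ip_ge0/Hr.
have almost_min e : 0 < e -> exists2 x, D x &
    forall y, D y -> nsq (P x - S f) <= nsq (P y - S f) + e.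
  move=> e0; have [_ [x Dx <-] hx] := inf_adherent e0 hi.
  exists x => // y Dy; apply/ltW/(lt_le_trans hx); rewrite lerD2r.
  by apply: ge_inf; [exact: hi.2|exists y].
pose A := nsq (S f) + 1.
pose K := 4 * A + 4 * C * A + nsq f + 1.
have SfA : nsq (S f) <= A by rewrite /A; lra.
have A1 : 1 <= A by rewrite /A lerDr ip_ge0.
have f0 : 0 <= nsq f by apply/ip_ge0/DH.
have CA : 0 <= C * A by rewrite mulr_ge0//; lra.
have K1 : 1 <= K by rewrite /K; nra.
(* The errors made by an almost-minimiser up to [s ^+ 4] are of order [s ^+ 2]
   in scalar products, hence of order [s] for the norm of [S r']. *)
have main s : 0 < s <= 1 -> exists2 x, D x & nsq (P x - S f) <= 4 * K * s.
  move=> /andP[s0 s1]; pose e := s ^+ 4.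
  have e0 : 0 < e by rewrite exprn_gt0.
  have e1 : e <= 1 by rewrite exprn_ile1// ltW.
  have [x Dx xmin] := almost_min e e0; exists x => //.
  set r := P x - S f.
  have HPx := PH Dx.
  have {}Hr : H r by exact: Hr.
  have orth z : D z -> ip r (P z) ^+ 2 <= e * nsq (P z).
    move=> Dz; have HPz := PH Dz.
    apply: discriminant => [||c]; [exact: ip_ge0|exact: ltW|].
    have Dxz : D (c *: z + x) by apply: DL.
    have HPxz := PH Dxz.
    have := xmin _ Dxz; rewrite -/r.
    have -> : nsq (P (c *: z + x) - S f) = nsq (r + c *: P z).
      apply: nsq_null; [exact: HB|by apply: HD => //; apply: HZ|].
      rewrite (_ : _ - _ = P (c *: z + x) - (c *: P z + P x)) ?P_linear//.
      rewrite /r -[in LHS](addrC (c *: P z)) addrA [c *: P z + P x - S f]addrC.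
      by rewrite opprD opprK addrA subrK.
    by rewrite nsqDZ//; lra.
  have P00 : nsq (P 0) = 0.
    have := @P_linear (- 1) 0 0 D0 D0.
    rewrite scaler0 addr0 => /nsq_null; rewrite scaleN1r addNr.
    move=> ->//; last by exact: PH.
    by have := @ipZl 0 0 0 H0 H0; rewrite scale0r mul0r.
  have rA : nsq r <= A.
    apply: (le_trans (xmin 0 D0)); rewrite /A -/r.
    suff -> : nsq (P 0 - S f) = nsq (S f) by lra.
    have HP0 := PH D0.
    rewrite nsqN//; apply: nsq_null => //; first exact: HB.
    have HN := HZ (- 1) HP0.
    by rewrite addrAC subrr sub0r -(scaleN1r (P 0)) ipZl// (ipC HP0 HN) ipZl// P00 !mulr0.
  have PxA : nsq (P x) <= 4 * A.
    by have := nsqD_le Hr Hf; rewrite /r subrK -/r; lra.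
  have [r' Dr' r'r] := D_dense Hr e0.
  have Hr' := DH Dr'; have Hd := HB Hr' Hr; have HPr' := PH Dr'; have HSr' := SH Dr'.
  have r'A : nsq r' <= 4 * A.
    by have := nsqD_le Hd Hr; rewrite subrK; lra.
  have Pr'K : nsq (P r') <= K.
    apply: (le_trans (Pb Dr')).
    by have := ler_wpM2l C0 r'A; rewrite /K; nra.
  have s20 : 0 <= s ^+ 2 by rewrite exprn_ge0// ltW.
  have Kss : (K * s ^+ 2) ^+ 2 = K * K * e by rewrite /e; ring.
  have eK X : X <= K -> e * X <= K * K * e.
    move=> XK; rewrite mulrC ler_pM2r//; nra.
  have i1 : ip r (P x) <= K * s ^+ 2.
    apply: le_sqr; first by nra.
    rewrite Kss (le_trans (orth _ Dx))// eK// (le_trans PxA)// /K.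
    by nra.
  have i2 : ip (r' - r) (S f) <= K * s ^+ 2.
    apply: le_sqr; first by nra.
    rewrite Kss (le_trans (cauchy_schwarz Hd Hf))//.
    apply: (@le_trans _ _ (e * nsq (S f))).
      by rewrite ler_wpM2r ?ip_ge0// ltW.
    by rewrite eK// (le_trans SfA)// /K; nra.
  have i3 : ip r (P r') <= K * s ^+ 2.
    apply: le_sqr; first by nra.
    by rewrite Kss (le_trans (orth _ Dr'))// eK.
  have i4 : ip (r' - r) (P r') <= K * s ^+ 2.
    apply: le_sqr; first by nra.
    rewrite Kss (le_trans (cauchy_schwarz Hd HPr'))//.
    apply: (@le_trans _ _ (e * nsq (P r'))).
      by rewrite ler_wpM2r ?ip_ge0// ltW.
    exact: eK.
  have i5 : nsq (S r') <= 2 * K * s ^+ 2.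
    by rewrite PS// PC//; move: i4; rewrite ipBl//; lra.
  have i6 : - ip r' (S f) <= 2 * K * s.
    apply: le_sqr; first by nra.
    rewrite sqrrN -SC// (le_trans (cauchy_schwarz HSr' (DH Df)))//.
    have fK : nsq f <= K by rewrite /K; nra.
    apply: (@le_trans _ _ (2 * K * s ^+ 2 * K)).
      by apply: ler_pM => //; exact: ip_ge0.
    by nra.
  have -> : nsq r = ip r (P x) + ip (r' - r) (S f) - ip r' (S f).
    by rewrite ipBl// {2}/r ipBr//; ring.
  have s2s : s ^+ 2 <= s by nra.
  by nra.
move=> e e0; have K8 : 0 < 8 * K by lra.
pose s := Num.min 1 (e / (8 * K)).
have s0 : 0 < s by rewrite lt_min ltr01 divr_gt0.
have s01 : 0 < s <= 1 by rewrite s0 ge_min lexx.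
have [x Dx hx] := main s s01.
exists x => //; apply: (le_lt_trans hx).
have : s <= e / (8 * K) by rewrite ge_min lexx orbT.
by rewrite ler_pdivlMr//; nra.
Qed.

End range_square.

Section semigroup.
Variables (S : R -> V -> V) (T : R).
Hypotheses (SH : forall t x, 0 <= t <= T -> D x -> H (S t x))
  (SS : forall s t x y, 0 <= s -> 0 <= t -> s + t <= T -> D x -> D y ->
     ip (S s x) (S t y) = ip (S (s + t) x) y)
  (SC : forall t x y, 0 <= t <= T -> D x -> D y -> ip (S t x) y = ip x (S t y))
  (Sb : exists t0 C, [/\ 0 < t0, 0 <= C &
     forall t x, 0 < t <= t0 -> t <= T -> D x -> nsq (S t x) <= C * nsq x])
  (Scont : forall x e, D x -> 0 < e -> exists2 d, 0 < d &
     forall t, 0 < t < d -> t <= T -> nsq (S t x - x) < e).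

Let le_of_pairing y K : H y -> 0 <= K -> (forall z, D z -> ip y z ^+ 2 <= K * nsq z) ->
  nsq y <= K.
Proof.
move=> Hy K0 hK; rewrite leNgt; apply/negP; set N := nsq y => KN.
have N0 : 0 < N by lra.
(* A test vector within relative distance [d] of [y] loses a factor of at most
   (1 + d)^2 / (1 - d)^2, which this [d] makes smaller than N / K. *)
pose d := (N - K) / (8 * N).
have d8 : 8 * d * N = N - K by rewrite /d; field; lra.
have d0 : 0 < d by rewrite /d divr_gt0//; lra.
have d1 : d <= 1 by nra.
have dN : 0 < d ^+ 2 * N by rewrite mulr_gt0// exprn_gt0.
have [z Dz zy] := D_dense Hy dN.
have Hz := DH Dz; have Hzy := HB Hz Hy.
set w := ip y (z - y).
have w1 : w ^+ 2 <= (d * N) ^+ 2.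
  apply: (le_trans (cauchy_schwarz Hy Hzy)); rewrite -/N.
  by have := ltW zy; nra.
have wd : w <= d * N by apply: le_sqr => //; nra.
have wd' : - w <= d * N by apply: le_sqr; [nra|rewrite sqrrN].
have yz : ip y z = N + w by rewrite /w ipBr// -/N; ring.
have zz : nsq z = N + 2 * w + nsq (z - y).
  by have := nsqDZ 1 Hy Hzy; rewrite scale1r [y + _]addrC subrK -/N -/w => ->; ring.
have := hK z Dz; rewrite yz zz => h.
have h2 : (N + w) ^+ 2 <= K * (N + 2 * (d * N) + d ^+ 2 * N).
  by apply: (le_trans h); rewrite ler_wpM2l//; lra.
have h3 : (N - d * N) ^+ 2 <= (N + w) ^+ 2 by nra.
have h4 : N * (N * (1 - d) ^+ 2) <= N * (K * (1 + d) ^+ 2).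
  have -> : N * (N * (1 - d) ^+ 2) = (N - d * N) ^+ 2 by ring.
  have -> : N * (K * (1 + d) ^+ 2) = K * (N + 2 * (d * N) + d ^+ 2 * N) by ring.
  exact: le_trans h3 h2.
move: h4; rewrite ler_pM2l// => h4.
have d2 : d ^+ 2 <= d by nra.
by nra.
Qed.

(** By the semigroup identity, a bound for S_s gives one for S_(2s) through
    |(S_(2s) x, z)| = |(S_s x, S_s z)|, so any time is reached by doublings from
    a small one. *)
Let bounded_semigroup t : 0 < t <= T -> exists C, 0 <= C /\
  forall x, D x -> nsq (S t x) <= C * nsq x.
Proof.
have [t0 [C0 [t00 C00 hC]]] := Sb.
have double s : 0 < s -> 2 * s <= T ->
    (exists C, 0 <= C /\ forall x, D x -> nsq (S s x) <= C * nsq x) ->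
    exists C, 0 <= C /\ forall x, D x -> nsq (S (2 * s) x) <= C * nsq x.
  move=> s0 sT [C [C1 CS]]; exists (C * C); split; first exact: mulr_ge0.
  move=> x Dx; have sT' : 0 <= 2 * s <= T by lra.
  have nx := ip_ge0 (DH Dx).
  apply: le_of_pairing => [||z Dz]; [exact: SH|by rewrite !mulr_ge0|].
  have s2 : s + s = 2 * s by ring.
  rewrite -s2 -SS//; [|lra|lra|lra].
  have HSx : H (S s x) by apply: SH => //; lra.
  have HSz : H (S s z) by apply: SH => //; lra.
  apply: (le_trans (cauchy_schwarz HSx HSz)).
  have -> : C * C * nsq x * nsq z = (C * nsq x) * (C * nsq z) by ring.
  by apply: ler_pM; rewrite ?ip_ge0// CS.
move=> tT; have [k hk] : exists k, t / 2 ^+ k <= t0.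
  pose m := Num.bound (t / t0).
  have hm : t / t0 < m%:R by apply: archi_boundP; rewrite divr_ge0//; lra.
  exists m; rewrite ler_pdivrMr ?exprn_gt0// mulrC -ler_pdivrMr// ltW//.
  by apply: (lt_trans hm); rewrite -natrX ltr_nat ltn_expl.
elim: k t tT hk => [|k IH] t tT hk.
  by exists C0; split => // x Dx; apply: hC => //; move: hk; rewrite expr0 divr1; lra.
have -> : t = 2 * (t / 2) by field.
apply: double; [lra|lra|apply: IH; first lra].
by move: hk; rewrite exprS invfM mulrA.
Qed.

(** The closure of the range of S_t contains the range of S_(t/2), hence that of
    S_(t/2^k) for all [k], and S_(t/2^k) f tends to [f]. *)
Lemma dense_range_semigroup t : 0 < t <= T -> forall g, H g ->
  forall e, 0 < e -> exists2 x, D x & nsq (S t x - g) < e.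
Proof.
move=> tT.
have half s : 0 < s <= T -> forall f, D f -> forall e, 0 < e ->
    exists2 x, D x & nsq (S s x - S (s / 2) f) < e.
  move=> sT f Df e e0; have [C [C0 Cb]] := bounded_semigroup sT.
  apply: (@range_sqrt_sub_closure_range (S s) (S (s / 2)) C) => //.
  - by move=> x Dx; apply: SH => //; lra.
  - by move=> x Dx; apply: SH => //; lra.
  - by move=> x y Dx Dy; rewrite SS//; try lra; rewrite -splitr.
  - by move=> x y Dx Dy; apply: SC => //; lra.
  - by move=> x y Dx Dy; apply: SC => //; lra.
have dyadic k : forall f, D f -> forall e, 0 < e ->
    exists2 x, D x & nsq (S t x - S (t / 2 ^+ k) f) < e.
  elim: k => [|k IH] f Df e e0.
    rewrite expr0 divr1; exists f => //; rewrite subrr.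
    by have := @ipZl 0 0 0 H0 H0; rewrite scale0r mul0r => ->.
  have e4 : 0 < e / 4 by lra.
  have k0 : 0 < 2 ^+ k :> R by rewrite exprn_gt0.
  have k1 : 1 <= 2 ^+ k :> R by rewrite exprn_ege1//; lra.
  have sT : 0 < t / 2 ^+ k <= T.
    rewrite divr_gt0//=; last by lra.
    rewrite ler_pdivrMr//; nra.
  have [y Dy hy] := half _ sT f Df _ e4.
  have [x Dx hx] := IH y Dy _ e4.
  exists x => //; set u := S t x in hx *; set v := S (t / 2 ^+ k) y in hx hy.
  have -> : t / 2 ^+ k.+1 = t / 2 ^+ k / 2 by rewrite exprS; field; lra.
  set w := S _ f in hy *.
  have Hu : H u by apply: SH => //; lra.
  have Hv : H v by apply: SH => //; lra.
  have Hw : H w by apply: SH => //; lra.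
  have -> : u - w = (u - v) + (v - w) by rewrite addrA subrK.
  by have := nsqD_le (HB Hu Hv) (HB Hv Hw); lra.
move=> g Hg e e0.
have e16 : 0 < e / 16 by lra.
have [f Df fg] := D_dense Hg e16.
have [d d0 fd] := Scont Df e16.
have [k hk] : exists k, t / 2 ^+ k < d.
  pose m := Num.bound (t / d).
  have hm : t / d < m%:R by apply: archi_boundP; rewrite divr_ge0//; lra.
  exists m; rewrite ltr_pdivrMr ?exprn_gt0// mulrC -ltr_pdivrMr//.
  by apply: (lt_trans hm); rewrite -natrX ltr_nat ltn_expl.
have k0 : 0 < 2 ^+ k :> R by rewrite exprn_gt0.
have k1 : 1 <= 2 ^+ k :> R by rewrite exprn_ege1//; lra.
have sT : 0 < t / 2 ^+ k <= T.
  rewrite divr_gt0//=; last by lra.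
  rewrite ler_pdivrMr//; nra.
have e4 : 0 < e / 4 by lra.
have [x Dx hx] := dyadic k f Df _ e4.
exists x => //.
have {fd}fd : nsq (S (t / 2 ^+ k) f - f) < e / 16 by apply: fd; lra.
set u := S t x in hx *; set v := S (t / 2 ^+ k) f in hx fd.
have Hu : H u by apply: SH => //; lra.
have Hv : H v by apply: SH => //; lra.
have Hf := DH Df.
have h1 := nsqD_le (HB Hv Hf) (HB Hf Hg).
have h2 := nsqD_le (HB Hu Hv) (HB Hv Hg).
move: h1 h2; rewrite !addrA !subrK.
by lra.
Qed.

End semigroup.
End abstract_density.

(** * Lebesgue measure on row vectors *)

Section rV_boxes.
Variables (R : realType) (n : nat).
Local Notation rV := 'rV[R]_n.+1.

Definition open_box (l r : rV) : set rV :=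
  [set x | forall i, l ord0 i < x ord0 i < r ord0 i].

Definition closed_box (l r : rV) : set rV :=
  [set x | forall i, l ord0 i <= x ord0 i <= r ord0 i].

Lemma coord_le_norm (x : rV) i : `|x ord0 i| <= `|x|.
Proof.
rewrite [leRHS]/Num.norm /= mx_normrE; apply/bigmax_geP; right => /=.
by exists (ord0, i).
Qed.

Lemma measurable_open_box (l r : rV) : measurable (open_box l r).
Proof.
have -> : open_box l r =
    \bigcap_(i in [set: 'I_n.+1]) (rV_coord i @^-1` `]l ord0 i, r ord0 i[).
  apply/seteqP; split => x /= h i.
    by move=> _; rewrite /rV_coord/= in_itv/=.
  by have := h i Logic.I; rewrite /rV_coord/= in_itv/=.
apply: fin_bigcap_measurable => // i _.
by rewrite -[X in measurable X]setTI; apply: measurable_rV_coord.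
Qed.

(** The boxes are those with rational corners. An index that does not encode
    an admissible box gets the empty box with corners 1 and 0. *)
Lemma open_bigcup_boxes (A : set rV) : open A -> exists l r : nat -> rV,
  A = \bigcup_k open_box (l k) (r k) /\ forall k, closed_box (l k) (r k) `<=` A.
Proof.
move=> oA.
pose toR (v : 'rV[rat]_n.+1) : rV := map_mx ratr v.
pose good (k : nat) (p : 'rV[rat]_n.+1 * 'rV[rat]_n.+1) :=
  unpickle k = Some p /\ closed_box (toR p.1) (toR p.2) `<=` A.
have /choice[lr lrP] : forall k : nat, exists lr : rV * rV,
    ((exists p, good k p /\ lr = (toR p.1, toR p.2)) \/
     ((~ exists p, good k p) /\ lr = (const_mx 1, 0))).
  move=> k; have [[p gp]|np] := pselect (exists p, good k p).
    by exists (toR p.1, toR p.2); left; exists p.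
  by exists (const_mx 1, 0); right.
exists (fun k => (lr k).1), (fun k => (lr k).2); split; last first.
  move=> k; have [[p [[_ pA] ->]]//|[_ ->]] := lrP k.
  by move=> x /= /(_ ord0); rewrite !mxE; lra.
apply/seteqP; split; last first.
  move=> x [k _]; have [[p [[_ pA] ->]]|[_ ->]] := lrP k.
    by move=> xp; apply: pA => i; have /andP[/ltW -> /ltW ->] := xp i.
  by move=> /= /(_ ord0); rewrite !mxE; lra.
move=> x Ax.
have /nbhs_ballP[e /= e0 xeA] : nbhs x A by exact: open_nbhs_nbhs.
have e2 : 0 < e / 2 by lra.
have lex i : exists q : rat, x ord0 i - e / 2 < ratr q < x ord0 i.
  have /rat_in_itvoo[q] : x ord0 i - e / 2 < x ord0 i by lra.
  by rewrite in_itv/= => h; exists q.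
have rex i : exists q : rat, x ord0 i < ratr q < x ord0 i + e / 2.
  have /rat_in_itvoo[q] : x ord0 i < x ord0 i + e / 2 by lra.
  by rewrite in_itv/= => h; exists q.
have [ql qlP] := choice lex; have [qr qrP] := choice rex.
pose p : 'rV[rat]_n.+1 * 'rV[rat]_n.+1 := (\row_i ql i, \row_i qr i).
have pgood : good (pickle p) p.
  split; first by rewrite pickleK.
  move=> y yp; apply: xeA; split => // i j; rewrite (ord1 i).
  have := yp j; have := qlP j; have := qrP j; rewrite !mxE /ball/= ltr_norml.
  by move=> ? ? ?; apply/andP; split; lra.
exists (pickle p) => //; have [[p' [[]]]|[]] := lrP (pickle p); last first.
  by move=> h; exfalso; apply: h; exists p.
rewrite pickleK => -[<-] _ -> i; rewrite !mxE.
by have := qlP i; have := qrP i; lra.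
Qed.

(** The measurable sets are generated by the coordinates; the countability of
    the boxes puts the open sets among them. *)
Lemma open_measurable_rV (A : set rV) : open A -> measurable A.
Proof.
move=> /open_bigcup_boxes[l [r [-> _]]].
by apply: bigcup_measurable => k _; exact: measurable_open_box.
Qed.

Lemma continuous_measurable_rV (f : rV -> R) : continuous f -> measurable_fun setT f.
Proof.
move=> /continuousP cf; apply: (measurability _ (RGenOpens.measurableE R)).
move=> _ [_ [a [b ->] <-]]; rewrite setTI; apply: open_measurable_rV.
exact/cf/interval_open.
Qed.

End rV_boxes.

Section rV_cube.
Variable R : realType.

Let cube n (M : R) : set 'rV[R]_n := [set x | forall i, x ord0 i \in `[- M, M]].

Let measurable_cube n M : measurable (@cube n M).
Proof.
have -> : @cube n M = \bigcap_(i in [set: 'I_n]) (rV_coord i @^-1` `[- M, M]).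
  apply/seteqP; split => x /= h i; first by move=> _; exact: h.
  exact: (h i Logic.I).
apply: fin_bigcap_measurable => // i _.
by rewrite -[X in measurable X]setTI; apply: measurable_rV_coord.
Qed.

Let leb_cube_lty n M : (leb R n (@cube n M) < +oo)%E.
Proof.
elim: n => [|n IH]; first by rewrite /= diracE ltry.
rewrite /= /leb_step /pushforward.
have -> : @rV_cons R n @^-1` @cube n.+1 M = `[- M, M]%classic `*` @cube n M.
  apply/seteqP; split => -[t y] /= => [h|[h1 h2] i].
    split; first by have := h ord0; rewrite mxE unlift_none.
    by move=> i; have := h (lift ord0 i); rewrite mxE liftK.
  by rewrite mxE; case: unliftP => [j _|_] /=; [exact: h2|exact: h1].
rewrite product_measure1E//; last exact: measurable_cube.
rewrite lte_mul_pinfty//.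
suff : lebesgue_measure (`[- M, M] : set R) \is a fin_num by [].
by rewrite lebesgue_measure_itv/= lte_fin; case: ifPn.
Qed.

Lemma leb_bounded_lty n (A : set 'rV[R]_n.+1) : measurable A -> bounded_set A ->
  (leb R n.+1 A < +oo)%E.
Proof.
move=> mA /pinfty_ex_gt0[M M0 AM].
apply: (le_lt_trans _ (@leb_cube_lty n.+1 M)).
apply: le_measure; rewrite ?inE//; first exact: measurable_cube.
move=> x /AM/= xM i; rewrite in_itv/=.
by have := le_trans (coord_le_norm x i) xM; rewrite ler_norml.
Qed.

End rV_cube.

(** * Smooth functions with compact support *)

Section smooth_algebra.
Variables (R : realType) (V : normedModType R).
Implicit Types f g : V -> R.

(** The recursion peels off the innermost derivative, whereas that of
    [iter_derive] peels off the outermost one; in this order the product rule can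
    be iterated. *)
Fixpoint Ck (k : nat) f : Prop :=
  if k is k'.+1 then
    [/\ continuous f, forall x v, derivable f x v & forall v, Ck k' (fun x => 'D_v f x)]
  else continuous f.

Let iter_derive_rcons vs v f :
  iter_derive (rcons vs v) f = iter_derive vs (fun x => 'D_v f x).
Proof. by elim: vs => //= w vs ->. Qed.

Lemma smooth_onTP f : smooth_on setT f <-> forall k, Ck k f.
Proof.
split=> [sf k|Cf].
  elim: k f sf => [|k IH] f sf /=; first by move=> x; have [] := sf [::] x Logic.I.
  split=> [x|x|v]; [by have [] := sf [::] x Logic.I|by have [] := sf [::] x Logic.I|].
  by apply: IH => vs x _; rewrite -iter_derive_rcons; exact: sf.
move=> vs x _.
have : Ck (size vs).+1 f by [].
elim/last_ind: vs f {Cf} => [f [cf df _]|vs v IH f]; first by split; [exact: cf|move=> v; exact: df].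
by rewrite size_rcons iter_derive_rcons => -[_ _ /(_ v)]; exact: IH.
Qed.

Lemma Ck_continuous k f : Ck k f -> continuous f.
Proof. by case: k => [//|k] []. Qed.

Lemma CkS k f : Ck k.+1 f -> Ck k f.
Proof.
elim: k f => [f []//|k IH f [cf df Df]]; split => // v.
by apply: IH; exact: Df.
Qed.

Lemma Ck_cst k (c : R) : Ck k (fun=> c).
Proof.
elim: k c => [|k IH] c; first by move=> x; exact: cvg_cst.
split=> [x|x v|v]; [exact: cvg_cst|exact: derivable_cst|].
rewrite (_ : (fun x => 'D_v _ x) = (fun=> 0)); first exact: IH.
by apply/funext => x; exact: derive_cst.
Qed.

Lemma CkD k f g : Ck k f -> Ck k g -> Ck k (fun x => f x + g x).
Proof.
elim: k f g => [|k IH] f g.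
  by move=> cf cg x; apply: cvgD; [exact: cf|exact: cg].
move=> [cf df Df] [cg dg Dg]; split=> [x|x v|v].
- by apply: cvgD; [exact: cf|exact: cg].
- by apply: derivableD; [exact: df|exact: dg].
rewrite (_ : (fun x => 'D_v _ x) = (fun x => 'D_v f x + 'D_v g x)); first exact: (IH _ _ (Df v) (Dg v)).
by apply/funext => x; apply: deriveD; [exact: df|exact: dg].
Qed.

Lemma CkM k f g : Ck k f -> Ck k g -> Ck k (fun x => f x * g x).
Proof.
elim: k f g => [|k IH] f g.
  by move=> cf cg x; apply: cvgM; [exact: cf|exact: cg].
move=> Cf Cg; have Cf' := CkS Cf; have Cg' := CkS Cg.
case: Cf => [cf df Df]; case: Cg => [cg dg Dg]; split=> [x|x v|v].
- by apply: cvgM; [exact: cf|exact: cg].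
- by apply: derivableM; [exact: df|exact: dg].
rewrite (_ : (fun x => 'D_v _ x) = (fun x => f x * 'D_v g x + g x * 'D_v f x)).
  by apply: CkD; apply: IH => //; [exact: Dg|exact: Df].
by apply/funext => x; apply: deriveM; [exact: df|exact: dg].
Qed.

End smooth_algebra.

Section flat_function.
Variable R : realType.

(** The functions x^-m exp (- 1 / x), extended by 0 to x <= 0. Differentiation
    maps each of them to a linear combination of two others, so all are smooth. *)
Definition flat (m : nat) (x : R) : R :=
  if 0 < x then x^-1 ^+ m * expR (- x^-1) else 0.

Lemma flat_ge0 m x : 0 <= flat m x.
Proof. by rewrite /flat; case: ifPn => // x0; rewrite mulr_ge0 ?expR_ge0// exprn_ge0// invr_ge0 ltW. Qed.

Lemma flat0_lt1 x : flat 0 x < 1.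
Proof.
rewrite /flat; case: ifPn => // x0; rewrite expr0 mul1r -expR0 ltr_expR.
by rewrite oppr_lt0 invr_gt0.
Qed.

Lemma flat0_gt0 x : (0 < flat 0 x) = (0 < x).
Proof. by rewrite /flat; case: ifPn; rewrite ?ltxx// expr0 mul1r expR_gt0. Qed.

Lemma flat_le m x : 0 < x -> flat m x <= m.+1%:R ^+ m.+1 * x.
Proof.
move=> x0; rewrite /flat x0; set y := x^-1.
have y0 : 0 < y by rewrite invr_gt0.
have m0 : 0 < m.+1%:R :> R by rewrite ltr0n.
have -> : x = y^-1 by rewrite invrK.
rewrite -ler_pdivrMr ?invr_gt0// invrK mulrAC -exprSr expRN ler_pdivrMr ?expR_gt0//.
have -> : expR y = expR (y / m.+1%:R) ^+ m.+1 by rewrite -expRM_natl mulrC divfK// gt_eqF.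
have -> : y ^+ m.+1 = m.+1%:R ^+ m.+1 * (y / m.+1%:R) ^+ m.+1.
  by rewrite -exprMn mulrC divfK// gt_eqF.
rewrite ler_pM2l ?exprn_gt0//; apply: lerXn2r; rewrite ?nnegrE ?expR_ge0//.
  by rewrite divr_ge0// ltW.
by apply: le_trans (expR_ge1Dx _); rewrite lerDr.
Qed.

Lemma is_derive_flat m (x : R) :
  is_derive x 1 (flat m) (- m%:R * flat m.+1 x + flat m.+2 x).
Proof.
have [x0|x0|->] := ltgtP x 0.
- have -> : - m%:R * flat m.+1 x + flat m.+2 x = 0.
    by rewrite /flat ltNge (ltW x0)/= mulr0 addr0.
  have dc : is_derive x (1 : R) (cst (0 : R)) 0 by exact: is_derive_cst.
  apply: near_eq_is_derive dc.
  near=> y; rewrite /flat/= ltNge ifN// negbK ltW//.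
  by near: y; exact: lt_nbhsl.
- pose y := x^-1.
  have xn0 : x != 0 by rewrite gt_eqF.
  have dV : is_derive x 1 (fun z : R => z^-1) (- y ^+ 2).
    have h := @is_deriveV R id x 1 1 xn0 (is_derive_id x 1).
    by apply: (is_derive_eq h); rewrite /y exprVn scaleNr; congr (- _); exact: mulr1.
  have dX := @is_deriveX R R (fun z : R => z^-1) m x 1 _ dV.
  rewrite exprfctE in dX.
  have dE := @is_derive1_comp R expR (fun z : R => - z^-1) x _ _ (is_derive_expR _) (is_deriveN dV).
  have dM := @is_deriveM _ _ _ _ _ _ _ _ dX dE.
  have dF : is_derive x (1 : R) (fun z => z^-1 ^+ m * expR (- z^-1))
     (- m%:R * flat m.+1 x + flat m.+2 x).
    apply: (is_derive_eq dM); rewrite /flat x0 -/y /GRing.scale/=.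
    case: m {dX dM} => [|m] /=; first by rewrite -/y !expr0 mul0r; ring.
    by rewrite -natr1 -/y !exprS; ring.
  apply: near_eq_is_derive dF.
  near=> z; rewrite /flat ifT//.
  by near: z; exact: lt_nbhsr.
- have -> : - m%:R * flat m.+1 0 + flat m.+2 0 = 0 :> R.
    by rewrite /flat ltxx mulr0 addr0.
  have lim0 : (fun h : R => h^-1 *: (flat m (h *: (1 : R) + 0) - flat m 0)) @ 0^' --> (0 : R).
    apply/cvgrPdist_le => e e0.
    have C0 : 0 < m.+2%:R ^+ m.+2 :> R by rewrite exprn_gt0.
    near=> h.
    have h0 : h != 0 by near: h; exact: nbhs_dnbhs_neq.
    have hd : `|h| < e / m.+2%:R ^+ m.+2 by near: h; apply: dnbhs0_lt; rewrite divr_gt0.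
    rewrite sub0r normrN addr0 (_ : flat m 0 = 0) ?subr0; last by rewrite /flat ltxx.
    rewrite (_ : h *: (1 : R) = h); last exact: mulr1.
    have [hp|hn] := ltP 0 h; last by rewrite /flat ltNge hn/= scaler0 normr0 ltW.
    have -> : h^-1 *: flat m h = flat m.+1 h by rewrite /flat hp /GRing.scale/= mulrA -exprS.
    rewrite ger0_norm ?flat_ge0// (le_trans (flat_le _ hp))//.
    by rewrite mulrC -ler_pdivlMr// ltW// (le_lt_trans (ler_norm _)).
  apply: DeriveDef; first by apply/cvg_ex; exists 0.
  by apply/cvg_lim => //; exact: Rhausdorff.
Unshelve. all: by end_near. Qed.

End flat_function.

Section smooth_coordinates.
Variables (R : realType) (n : nat).
Local Notation rV := 'rV[R]_n.+1.

Lemma Ck_flat_coord k m (c be : R) (i : 'I_n.+1) :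
  Ck k (fun x : rV => flat m (c + be * x ord0 i)).
Proof.
have dfl mm (x v : rV) : is_derive x v (fun x : rV => flat mm (c + be * x ord0 i))
    (be * v ord0 i * (- mm%:R * flat mm.+1 (c + be * x ord0 i) + flat mm.+2 (c + be * x ord0 i))).
  pose w := be * v ord0 i; pose y := c + be * x ord0 i.
  have dl : is_derive (0 : R) (1 : R) (fun h : R => y + h * w) w.
    by apply: is_derive_eq; rewrite /GRing.scale/=; ring.
  have := @is_derive1_comp R (flat mm) (fun h : R => y + h * w) 0 _ _ (is_derive_flat mm _) dl.
  rewrite mul0r addr0 mulrC => -[df dfE].
  have eqf : (fun h : R => h^-1 *: ((flat mm \o (fun h => y + h * w)) (h *: (1 : R) + 0) -
                           (flat mm \o (fun h => y + h * w)) 0))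
     = (fun h : R => h^-1 *: (((fun x : rV => flat mm (c + be * x ord0 i)) \o shift x) (h *: v) -
                           flat mm (c + be * x ord0 i))).
    apply/funext => h /=; rewrite mul0r !addr0 /y; congr (_ *: (flat mm _ - _)).
    by rewrite !mxE /w (_ : h *: (1 : R) = h); [ring|exact: mulr1].
  apply: DeriveDef; first by move: df; rewrite /derivable /shift/= eqf.
  by move: dfE; rewrite /derive /shift/= eqf.
have cfl mm : continuous (fun x : rV => flat mm (c + be * x ord0 i)).
  move=> x; apply: (@continuous_comp _ _ _ (fun x : rV => c + be * x ord0 i) (flat mm)).
    have cc := @cst_continuous rV R c; have cx := @coord_continuous R 1 n.+1 ord0 i.
    have cb := @cst_continuous rV R be.
    by have := cvgD (cc x) (cvgM (cb x) (cx x)); exact.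
  by apply: differentiable_continuous; apply/derivable1_diffP; have [] := is_derive_flat mm (c + be * x ord0 i).
elim: k m => [//|k IH] m; split=> [//|x v|v]; first by have [] := dfl m x v.
rewrite (_ : (fun x => 'D_v _ x) = (fun x : rV => be * v ord0 i *
    (- m%:R * flat m.+1 (c + be * x ord0 i) + flat m.+2 (c + be * x ord0 i)))).
  apply: CkM; first exact: Ck_cst.
  by apply: CkD => //; apply: CkM => //; exact: Ck_cst.
by apply/funext => x; have [] := dfl m x v.
Qed.

Variable A : set rV.
Implicit Types f g : rV -> R.

Lemma smooth_mul f g : smooth_on setT f -> smooth_on setT g ->
  smooth_on setT (fun x => f x * g x).
Proof. by move=> /smooth_onTP Cf /smooth_onTP Cg; apply/smooth_onTP => k; exact: CkM. Qed.

Lemma smooth_add f g : smooth_on setT f -> smooth_on setT g ->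
  smooth_on setT (fun x => f x + g x).
Proof. by move=> /smooth_onTP Cf /smooth_onTP Cg; apply/smooth_onTP => k; exact: CkD. Qed.

Lemma smooth_cst (c : R) : smooth_on [set: rV] (fun=> c).
Proof. by apply/smooth_onTP => k; exact: Ck_cst. Qed.

Lemma Cc_infty_continuous f : Cc_infty A f -> continuous f.
Proof. by case=> /smooth_onTP Cf _ _; exact: (Ck_continuous (Cf 0)). Qed.

Lemma Cc_infty_support f (K : set rV) : smooth_on setT f -> compact K -> K `<=` A ->
  (forall x, f x != 0 -> K x) -> Cc_infty A f.
Proof.
move=> sf cK KA fK.
have clK : closed K by apply: compact_closed => //; exact: norm_hausdorff.
have clfK : closure [set x | f x != 0] `<=` K.
  by move/closure_id : clK => ->; exact: closure_subset.
split => //; first exact: (subclosed_compact (@closed_closure _ _) cK).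
exact: subset_trans KA.
Qed.

Lemma Cc_infty_mul f g : Cc_infty A f -> smooth_on setT g ->
  Cc_infty A (fun x => f x * g x).
Proof.
move=> [sf cf fA] sg.
apply: (Cc_infty_support _ cf fA); first exact: smooth_mul.
move=> x fg; apply: subset_closure => /=.
by apply: contraNneq fg => ->; rewrite mul0r.
Qed.

Lemma Cc_infty_add f g : Cc_infty A f -> Cc_infty A g ->
  Cc_infty A (fun x => f x + g x).
Proof.
move=> [sf cf fA] [sg cg gA].
apply: (Cc_infty_support _ (compactU cf cg)); first exact: smooth_add.
  by move=> x [/fA|/gA].
move=> x fg; have [fx|fx] := eqVneq (f x) 0; last by left; exact: subset_closure.
by right; apply: subset_closure => /=; rewrite fx add0r in fg.
Qed.

Lemma Cc_infty0 : Cc_infty A (fun=> 0).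
Proof.
apply: (@Cc_infty_support _ set0) => //; [exact: smooth_cst|exact: compact0|].
by move=> x; rewrite eqxx.
Qed.

Lemma Cc_inftyZ (c : R) f : Cc_infty A f -> Cc_infty A (fun x => c * f x).
Proof.
move=> Cf; have := Cc_infty_mul Cf (smooth_cst c).
by under eq_fun do rewrite mulrC.
Qed.

Lemma Cc_infty_bounded f : Cc_infty A f -> exists2 M, 0 <= M & forall x, `|f x| <= M.
Proof.
move=> Cf; have cf := Cc_infty_continuous Cf; case: Cf => _ cK _.
have [M [Mr hM]] : bounded_set (f @` closure [set x | f x != 0]).
  by apply: compact_bounded; apply: continuous_compact => //; exact: continuous_subspaceT.
exists (Num.max 0 (M + 1)); first by rewrite le_max lexx.
move=> x; have [->|fx] := eqVneq (f x) 0; first by rewrite normr0 le_max lexx.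
rewrite le_max; apply/orP; right; apply: (hM (M + 1)); first by rewrite ltrDl.
by exists x => //; apply: subset_closure.
Qed.

(** The function is the product, over the coordinates, of [flat 0] applied to
    the signed distances to the two faces. *)
Lemma bump_open_box (l r : rV) : closed_box l r `<=` A -> exists g,
  [/\ Cc_infty A g, forall x, 0 <= g x <= 1 & forall x, 0 < g x <-> open_box l r x].
Proof.
move=> lrA.
pose t (i : 'I_n.+1) (x : rV) := flat 0 (- l ord0 i + 1 * x ord0 i) * flat 0 (r ord0 i + (- 1) * x ord0 i).
have t01 i x : 0 <= t i x <= 1.
  rewrite /t mulr_ge0 ?flat_ge0//= mulr_ile1 ?flat_ge0//; exact/ltW/flat0_lt1.
have tgt i x : (0 < t i x) = (l ord0 i < x ord0 i < r ord0 i).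
  have tE : (0 < t i x) = (0 < flat 0 (- l ord0 i + 1 * x ord0 i)) && (0 < flat 0 (r ord0 i + (- 1) * x ord0 i)).
    rewrite /t; have [h|h|<-] := ltgtP 0 (flat 0 (- l ord0 i + 1 * x ord0 i)).
    - by rewrite pmulr_rgt0.
    - by have := flat_ge0 0 (- l ord0 i + 1 * x ord0 i); rewrite leNgt h.
    - by rewrite mul0r ltxx.
  by rewrite tE !flat0_gt0; congr andb; apply/idP/idP; lra.
pose g x := \prod_i t i x.
have g0 x : 0 <= g x by apply: prodr_ge0 => i _; have /andP[] := t01 i x.
exists g; split.
- have cK : compact (closed_box l r).
    have := @rV_compact R n.+1 (fun i => `[l ord0 i, r ord0 i]%classic) (fun i => @segment_compact _ _ _).
    rewrite (_ : [set v : rV | _] = closed_box l r)//.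
  apply: (Cc_infty_support _ cK lrA).
    apply/smooth_onTP => k; rewrite /g.
    have Cs (s : seq 'I_n.+1) : Ck k (fun x => \prod_(i <- s) t i x).
      elim: s => [|i s IH]; first by under eq_fun do rewrite big_nil; exact: Ck_cst.
      by under eq_fun do rewrite big_cons; apply: CkM => //; apply: CkM; exact: Ck_flat_coord.
    exact: Cs.
  move=> x gx i.
  have : 0 < t i x.
    rewrite lt_neqAle eq_sym; have /andP[-> _] := t01 i x; rewrite andbT.
    by apply: contraNneq gx => ti; rewrite /g (bigD1 i)//= ti mul0r.
  by rewrite tgt => /andP[/ltW -> /ltW ->].
- move=> x; rewrite g0/=; apply: prodr_ile1 => i _; exact: t01.
- move=> x; split=> [gx i|lr]; last by apply: prodr_gt0 => i _; rewrite tgt; exact: lr.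
  rewrite -tgt lt_neqAle eq_sym; have /andP[-> _] := t01 i x; rewrite andbT.
  by apply: contraTneq gx => ti; rewrite /g (bigD1 i)//= ti mul0r ltxx.
Qed.

(** For [0 <= f <= 1], these smooth functions of [f] increase to the indicator
    of the set where [f] is positive. *)
Definition sharpen (N : nat) f x : R := 1 - (1 - f x) ^+ N.

Lemma sharpen_in01 N f x : 0 <= f x <= 1 -> 0 <= sharpen N f x <= 1.
Proof.
move=> f01; rewrite /sharpen subr_ge0 exprn_ile1; [|lra|lra].
by rewrite lerBlDr lerDl exprn_ge0//; lra.
Qed.

Lemma smooth_sharpen N f : smooth_on setT f -> smooth_on setT (sharpen N f).
Proof.
move=> /smooth_onTP Cf; apply/smooth_onTP => k.
have C1 : Ck k (fun x => 1 + (- 1) * f x).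
  by apply: CkD; [exact: Ck_cst|apply: CkM => //; exact: Ck_cst].
have CX : Ck k (fun x => (1 + (- 1) * f x) ^+ N).
  elim: N => [|N IH]; first by under eq_fun do rewrite expr0; exact: Ck_cst.
  by under eq_fun do rewrite exprS; exact: CkM.
rewrite (_ : sharpen N f = (fun x => 1 + (- 1) * (1 + (- 1) * f x) ^+ N)).
  by apply: CkD; [exact: Ck_cst|apply: CkM => //; exact: Ck_cst].
by apply/funext => x; rewrite /sharpen !mulN1r.
Qed.

Lemma sharpen_eq0 N f x : f x = 0 -> sharpen N f x = 0.
Proof. by move=> fx; rewrite /sharpen fx subr0 expr1n subrr. Qed.

Lemma Cc_infty_sharpen N f : Cc_infty A f -> Cc_infty A (sharpen N f).
Proof.
move=> [sf cf fA]; apply: (Cc_infty_support _ cf fA); first exact: smooth_sharpen.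
move=> x hx; apply: subset_closure => /=; apply: contraNneq hx.
by move=> /(sharpen_eq0 N) ->.
Qed.

Lemma cvg_sharpen f x : 0 <= f x <= 1 ->
  sharpen N f x @[N --> \oo] --> (if 0 < f x then 1 else 0 : R).
Proof.
move=> f01; case: ifPn => [fx|]; last first.
  rewrite -leNgt => fx; have {}fx : f x = 0 by lra.
  by under eq_cvg do rewrite sharpen_eq0//; exact: cvg_cst.
rewrite -[X in _ --> X]subr0; apply: cvgB; first exact: cvg_cst.
by apply: cvg_expr; rewrite ger0_norm; lra.
Qed.

End smooth_coordinates.

(** * Density of smooth functions in L^2 *)

Section dominated_approximation.
Context d (X : measurableType d) (R : realType).
Variables (mu : {measure set X -> \bar R}) (D : set X).
Hypotheses (mD : measurable D) (Doo : (mu D < +oo)%E).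

Lemma integral_dist_small (h : nat -> X -> R) (g : X -> R) :
  (forall k, measurable_fun D (h k)) -> measurable_fun D g ->
  (forall k x, 0 <= h k x <= 1) -> (forall x, 0 <= g x <= 1) ->
  (forall x, D x -> h k x @[k --> \oo] --> g x) -> forall e : R, 0 < e ->
  exists k, (\int[mu]_(x in D) `|h k x - g x|%:E <= e%:E)%E.
Proof.
move=> mh mg h01 g01 hg e e0.
have [] := @dominated_convergence _ _ _ mu D mD (fun k x => (h k x)%:E)
  (EFin \o g) (cst 1%E).
- by move=> k; exact/measurable_EFinP.
- exact/measurable_EFinP.
- by apply: aeW => x Dx; apply/cvg_EFin; [exact: nearW|exact: hg].
- apply/integrableP; split; first exact: measurable_cst.
  by under eq_integral => x _ do rewrite /= normr1; rewrite integral_cst// mul1e.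
- by apply: aeW => x k Dx; rewrite /= lee_fin ger0_norm; have := h01 k x; lra.
move=> _ /fine_cvgP[fin0 lim0] _.
move/cvgrPdist_le : lim0 => /(_ _ e0) => lim0.
near \oo => k; exists k.
have fk : (\int[mu]_(x in D) `|(h k x)%:E - (g x)%:E|)%E \is a fin_num by near: k.
have : `|0 - fine (\int[mu]_(x in D) `|(h k x)%:E - (g x)%:E|)%E| <= e by near: k.
rewrite sub0r normrN => h1.
have -> : (\int[mu]_(x in D) `|h k x - g x|%:E = \int[mu]_(x in D) `|(h k x)%:E - (g x)%:E|)%E by [].
rewrite -(fineK fk) lee_fin (le_trans _ h1)// ler_norm//.
Unshelve. all: by end_near. Qed.

End dominated_approximation.

Section approximable_sets.
Variables (R : realType) (n : nat) (Omega : set 'rV[R]_n.+1).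
Local Notation rV := 'rV[R]_n.+1.
Local Notation mu := (leb R n.+1).
Hypotheses (oO : open Omega) (bO : bounded_set Omega).

Let mO : measurable Omega. Proof. exact: open_measurable_rV. Qed.
Let Ooo : (mu Omega < +oo)%E. Proof. exact: leb_bounded_lty. Qed.

Local Notation dist1 f g := (\int[mu]_(x in Omega) `|f x - g x|%:E)%E.

Let mind (A : set rV) : measurable A -> measurable_fun Omega (\1_A : rV -> R).
Proof. by move=> mA; apply: measurable_funTS; exact: measurable_indic. Qed.

Let mcont (f : rV -> R) : continuous f -> measurable_fun Omega f.
Proof. by move=> cf; apply: measurable_funTS; exact: continuous_measurable_rV. Qed.

Let dist1_triangle (f g F G : rV -> R) (h : rV -> R) (e : R) :
  measurable_fun Omega f -> measurable_fun Omega g ->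
  measurable_fun Omega F -> measurable_fun Omega G -> measurable_fun Omega h ->
  (forall x, Omega x -> `|h x| <= `|f x - F x| + `|g x - G x|) ->
  (dist1 f F <= (e / 2)%:E)%E -> (dist1 g G <= (e / 2)%:E)%E ->
  (\int[mu]_(x in Omega) `|h x|%:E <= e%:E)%E.
Proof.
move=> mf mg mF mG mh hle fF gG.
have mfF : measurable_fun Omega (fun x => `|f x - F x|).
  by apply: measurableT_comp => //; exact: measurable_funB.
have mgG : measurable_fun Omega (fun x => `|g x - G x|).
  by apply: measurableT_comp => //; exact: measurable_funB.
apply: (@le_trans _ _ (dist1 f F + dist1 g G)%E).
  rewrite -ge0_integralD//; [|exact/measurable_EFinP..].
  apply: ge0_le_integral => //.
  - by apply/measurable_EFinP; exact: measurableT_comp.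
  by apply: emeasurable_funD; exact/measurable_EFinP.
by rewrite [e]splitr EFinD leeD.
Qed.

(** These sets form a sigma-algebra that contains the half-spaces bounding one
    coordinate, hence all measurable sets. The values in [0, 1] make the class
    stable under union, by f + g - f g, and complement. *)
Definition approximable (A : set rV) := measurable A /\
  forall e : R, 0 < e -> exists f, [/\ Cc_infty Omega f, forall x, 0 <= f x <= 1 &
    (dist1 f (\1_A : rV -> R) <= e%:E)%E].

Let ind01 (A : set rV) x : 0 <= (\1_A x : R) <= 1.
Proof. by rewrite indicE; case: (x \in A); rewrite ?lexx ?ler01. Qed.

Let approximable_lim (A : set rV) (B : nat -> set rV) : measurable A ->
  (forall k, approximable (B k)) ->
  (forall x, Omega x -> (\1_(B k) x : R) @[k --> \oo] --> (\1_A x : R)) ->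
  approximable A.
Proof.
move=> mA aB BA; split => // e e0; have e2 : 0 < e / 2 by lra.
have [k hk] := integral_dist_small mO Ooo (fun k => mind (proj1 (aB k))) (mind mA)
  (fun k => ind01 (B k)) (ind01 A) BA e2.
have [f [Cf f01 hf]] := proj2 (aB k) _ e2.
have mf := mcont (Cc_infty_continuous Cf).
have mB := mind (proj1 (aB k)); have mA' := mind mA.
exists f; split => //; apply: (dist1_triangle mf mB mB mA' _ _ hf hk).
  exact: measurable_funB.
move=> x _; rewrite (_ : f x - \1_A x = (f x - \1_(B k) x) + (\1_(B k) x - \1_A x)); last by ring.
exact: ler_normD.
Qed.

Let approximable0 : approximable set0.
Proof.
split => // e e0; exists (fun=> 0); split; first exact: Cc_infty0.
  by move=> x; rewrite lexx ler01.
rewrite integral0_eq ?lee_fin ?ltW// => x _.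
by rewrite indic0 subrr normr0.
Qed.

Let approximableU (A B : set rV) : approximable A -> approximable B -> approximable (A `|` B).
Proof.
move=> [mA hA] [mB hB]; split; first exact: measurableU.
move=> e e0; have e2 : 0 < e / 2 by lra.
have [f [Cf f01 hf]] := hA _ e2; have [g [Cg g01 hg]] := hB _ e2.
have mf := mcont (Cc_infty_continuous Cf); have mg := mcont (Cc_infty_continuous Cg).
exists (fun x => f x + g x * (1 + (- 1) * f x)); split.
- apply: Cc_infty_add => //; apply: Cc_infty_mul => //.
  by apply: smooth_add; [exact: smooth_cst|apply: smooth_mul; [exact: smooth_cst|case: Cf]].
- by move=> x; have := f01 x; have := g01 x; nra.
apply: (dist1_triangle mf mg (mind mA) (mind mB) _ _ hf hg).
  apply: measurable_funB; last by apply: mind; exact: measurableU.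
  apply: measurable_funD => //; apply: measurable_funM => //.
  by apply: measurable_funD => //; apply: measurable_funM.
move=> x _; have -> : \1_(A `|` B) x = \1_A x + \1_B x - \1_A x * \1_B x :> R.
  by rewrite !indicE in_setU; case: (x \in A); case: (x \in B) => /=; ring.
have := f01 x; have := g01 x; have := ind01 A x; have := ind01 B x.
set a := \1_A x; set b := \1_B x; move=> b1 a1 g1 f1.
have -> : f x + g x * (1 + -1 * f x) - (a + b - a * b) = (f x - a) * (1 - g x) + (g x - b) * (1 - a) by ring.
apply: (le_trans (ler_normD _ _)); rewrite !normrM lerD//.
  by rewrite ler_piMr// ger0_norm; lra.
by rewrite ler_piMr// ger0_norm; lra.
Qed.

Let approximable_bigcup (A : nat -> set rV) : (forall k, approximable (A k)) ->
  approximable (\bigcup_k A k).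
Proof.
move=> aA.
pose B N := \big[setU/set0]_(k < N) A k.
have aB N : approximable (B N).
  by rewrite /B; elim/big_ind : _ => //; exact: approximable0.
apply: (approximable_lim _ aB); first by apply: bigcup_measurable => k _; case: (aA k).
move=> x _; have [[k _ Akx]|nA] := pselect ((\bigcup_k A k) x); last first.
  rewrite indicE memNset//.
  rewrite (_ : (fun k => _) = fun=> 0); first exact: cvg_cst.
  apply/funext => N; rewrite indicE memNset// /B -bigcup_mkord => -[j _ Ajx].
  by apply: nA; exists j.
rewrite [X in _ --> X]indicE mem_set; last by exists k.
apply: cvg_near_cst; exists k.+1 => // N /= kN.
by rewrite indicE mem_set// /B -bigcup_mkord; exists k.
Qed.

Let approximable_open_box (l r : rV) : closed_box l r `<=` Omega ->
  approximable (open_box l r).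
Proof.
move=> lrO; split; first exact: measurable_open_box.
move=> e e0; have [g [Cg g01 gbox]] := bump_open_box lrO.
have mg N : measurable_fun Omega (sharpen N g).
  by apply: mcont; apply: (Cc_infty_continuous (A := Omega)); exact: Cc_infty_sharpen.
have mB := mind (measurable_open_box l r).
have cvgB x : Omega x -> sharpen N g x @[N --> \oo] --> (\1_(open_box l r) x : R).
  move=> _; have := cvg_sharpen (g01 x); rewrite indicE.
  have -> : x \in open_box l r = (0 < g x); last by case: (0 < g x).
  by apply/idP/idP => [/set_mem/gbox//|gx]; apply/mem_set/gbox.
have [N hN] := integral_dist_small mO Ooo mg mB (fun N x => sharpen_in01 N (g01 x))
   (ind01 _) cvgB e0.
exists (sharpen N g); split => //; first exact: Cc_infty_sharpen.
by move=> x; exact: sharpen_in01.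
Qed.

Let approximable_domain : approximable Omega.
Proof.
have [l [r [OE lrO]]] := open_bigcup_boxes oO.
by rewrite OE; apply: approximable_bigcup => k; apply: approximable_open_box; rewrite -?OE.
Qed.

(** A smooth function without compact support may replace the test function:
    it can be multiplied by one that is close to 1 in [Omega]. *)
Let approximable_smooth (A : set rV) : measurable A ->
  (forall e : R, 0 < e -> exists f, [/\ smooth_on setT f, forall x, 0 <= f x <= 1 &
    (dist1 f (\1_A : rV -> R) <= e%:E)%E]) -> approximable A.
Proof.
move=> mA hA; split => // e e0; have e2 : 0 < e / 2 by lra.
have [f [Cf f01 hf]] := hA _ e2; have [g [Cg g01 hg]] := proj2 approximable_domain _ e2.
have cf : continuous f by move: Cf => /smooth_onTP/(_ 0).
have mf := mcont cf; have mg := mcont (Cc_infty_continuous Cg).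
exists (fun x => g x * f x); split; first exact: Cc_infty_mul.
  by move=> x; have := f01 x; have := g01 x; nra.
apply: (dist1_triangle mf mg (mind mA) (mind mO) _ _ hf hg).
  by apply: measurable_funB; [exact: measurable_funM|exact: mind].
move=> x Ox; have -> : \1_Omega x = 1 :> R by rewrite indicE mem_set.
have := f01 x; have := g01 x; have := ind01 A x; set a := \1_A x => a1 g1 f1.
have -> : g x * f x - a = (f x - a) * g x + (g x - 1) * a by ring.
apply: (le_trans (ler_normD _ _)); rewrite !normrM lerD//.
  by rewrite ler_piMr// ger0_norm; lra.
by rewrite ler_piMr// ger0_norm; lra.
Qed.

Let approximableC (A : set rV) : approximable A -> approximable (~` A).
Proof.
move=> [mA hA]; apply: approximable_smooth; first exact: measurableC.
move=> e e0; have [f [Cf f01 hf]] := hA _ e0.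
exists (fun x => 1 + (- 1) * f x); split.
- by apply: smooth_add; [exact: smooth_cst|apply: smooth_mul; [exact: smooth_cst|case: Cf]].
- by move=> x; have := f01 x; lra.
apply: le_trans hf; rewrite le_eqVlt; apply/orP; left; apply/eqP.
apply: eq_integral => x _; rewrite -normrN; congr (`| _ |%:E).
by rewrite !indicE in_setC; case: (x \in A) => /=; ring.
Qed.

Let approximable_halfspace (i : 'I_n.+1) (c : R) :
  approximable (rV_coord i @^-1` `]c, +oo[).
Proof.
have mA : measurable (@rV_coord R n.+1 i @^-1` `]c, +oo[).
  by rewrite -[X in measurable X]setTI; apply: measurable_rV_coord.
apply: approximable_smooth => // e e0.
pose g (x : rV) := flat 0 (- c + 1 * x ord0 i).
have sg : smooth_on setT g by apply/smooth_onTP => k; exact: Ck_flat_coord.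
have g01 x : 0 <= g x <= 1 by rewrite flat_ge0 ltW// flat0_lt1.
have mg N : measurable_fun Omega (sharpen N g).
  by apply: mcont; have /smooth_onTP/(_ 0) := smooth_sharpen N sg.
have cvgA x : Omega x -> sharpen N g x @[N --> \oo] --> (\1_(rV_coord i @^-1` `]c, +oo[) x : R).
  move=> _; have := cvg_sharpen (g01 x); rewrite indicE.
  have -> : x \in rV_coord i @^-1` `]c, +oo[ = (0 < g x); last by case: (0 < g x).
  rewrite /g flat0_gt0; apply/idP/idP => [/set_mem/=|h].
    by rewrite in_itv/= andbT /rV_coord; lra.
  by apply/mem_set; rewrite /= in_itv/= andbT /rV_coord; lra.
have [N hN] := integral_dist_small mO Ooo mg (mind mA) (fun N x => sharpen_in01 N (g01 x))
   (ind01 _) cvgA e0.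
exists (sharpen N g); split => //; first exact: smooth_sharpen.
by move=> x; exact: sharpen_in01.
Qed.

Lemma measurable_approximable (A : set rV) : measurable A -> approximable A.
Proof.
suff : @measurable _ rV `<=` approximable by apply.
apply: smallest_sub; first split => /=.
- exact: approximable0.
- by move=> B aB; rewrite setTD; exact: approximableC.
- exact: approximable_bigcup.
rewrite -bigcup_seq; apply: bigcup_sub => i _ _ [C mC <-] /=; rewrite setTI.
suff : @measurable _ (measurableTypeR R) `<=` [set C | approximable (rV_coord i @^-1` C)] by apply.
rewrite (RGenOInfty.measurableE R); apply: smallest_sub; first split => /=.
- by rewrite preimage_set0; exact: approximable0.
- by move=> B' aB; rewrite setTD preimage_setC; exact: approximableC.
- by move=> F aF; rewrite preimage_bigcup; exact: approximable_bigcup.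
- by move=> _ [c ->]; exact: approximable_halfspace.
Qed.

End approximable_sets.

Section dense_square_integrable.
Variables (R : realType) (n : nat) (Omega : set 'rV[R]_n.+1).
Local Notation rV := 'rV[R]_n.+1.
Local Notation mu := (leb R n.+1).
Hypotheses (oO : open Omega) (bO : bounded_set Omega).

Let mO : measurable Omega. Proof. exact: open_measurable_rV. Qed.

Local Notation sq f := (\int[mu]_(x in Omega) ((f x) ^+ 2)%:E)%E.

Let msq (f : rV -> R) : measurable_fun Omega f ->
  measurable_fun Omega (fun x => (f x ^+ 2)%:E).
Proof. by move=> mf; apply/measurable_EFinP; exact: measurable_funX. Qed.

Let sq_le (f g h : rV -> R) (e : R) : measurable_fun Omega f -> measurable_fun Omega g ->
  measurable_fun Omega h -> (forall x, Omega x -> h x = f x + g x) ->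
  (sq f <= (e / 4)%:E)%E -> (sq g <= (e / 4)%:E)%E -> (sq h <= e%:E)%E.
Proof.
move=> mf mg mh hE hf hg.
have e4 : e%:E = (2%:E * (e / 4)%:E + 2%:E * (e / 4)%:E)%E.
  by rewrite -!EFinM -EFinD; congr EFin; field.
apply: (@le_trans _ _ (2%:E * sq f + 2%:E * sq g)%E); last first.
  by rewrite e4 leeD// lee_pmul2l.
have nn (k : rV -> R) x : Omega x -> (0%R <= (k x ^+ 2)%:E)%E by rewrite lee_fin sqr_ge0.
rewrite -!ge0_integralZl//; [|exact: msq|exact: nn|exact: msq|exact: nn].
rewrite -ge0_integralD//; last 4 first.
- by move=> x Ox; rewrite mule_ge0// nn.
- by apply: measurable_funeM; exact: msq.
- by move=> x Ox; rewrite mule_ge0// nn.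
- by apply: measurable_funeM; exact: msq.
apply: ge0_le_integral => //.
- by move=> x Ox; exact: nn.
- exact: msq.
- by apply: emeasurable_funD; apply: measurable_funeM; exact: msq.
- move=> x Ox; rewrite -!EFinM -EFinD lee_fin hE//.
  by have := sqr_ge0 (f x - g x); nra.
Qed.

(** This class is stable under linear combinations and limits in mean square,
    and it contains the indicators of measurable sets. *)
Let closure2 (g : rV -> R) := measurable_fun Omega g /\
  forall e : R, 0 < e -> exists2 f, Cc_infty Omega f &
    (sq (fun x => (f x - g x)%R) <= e%:E)%E.

Let mCc f : Cc_infty Omega f -> measurable_fun Omega f.
Proof. by move=> Cf; apply: measurable_funTS; apply: continuous_measurable_rV; exact: Cc_infty_continuous Cf. Qed.

Let closure2_indic (A : set rV) : measurable A -> closure2 (\1_A : rV -> R).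
Proof.
move=> mA; split; first by apply: measurable_funTS; exact: measurable_indic.
move=> e e0; have [_ /(_ e e0)[f [Cf f01 hf]]] := measurable_approximable oO bO mA.
exists f => //; apply: le_trans hf; have mf := mCc Cf.
have mi : measurable_fun Omega (fun x => f x - \1_A x).
  by apply: measurable_funB => //; apply: measurable_funTS; exact: measurable_indic.
apply: ge0_le_integral => //.
- by move=> x _; rewrite lee_fin sqr_ge0.
- exact: msq.
- by apply/measurable_EFinP; exact: measurableT_comp.
move=> x Ox; rewrite lee_fin -real_normK ?num_real// expr2 ler_piMr//.
by have := f01 x; rewrite indicE; case: (x \in A) => /= ?; rewrite ler_norml; lra.
Qed.

Let closure2Z (c : R) g : closure2 g -> closure2 (fun x => c * g x).
Proof.
move=> [mg hg]; split; first exact: measurable_funM.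
move=> e e0; have [->|c0] := eqVneq c 0.
  exists (fun=> 0); first exact: Cc_infty0.
  by rewrite integral0_eq ?lee_fin ?ltW// => x _; rewrite mul0r subr0 expr0n.
have c2 : 0 < c ^+ 2 by rewrite exprn_even_gt0.
have [|f Cf hf] := hg (e / c ^+ 2); first by rewrite divr_gt0.
exists (fun x => c * f x); first exact: Cc_inftyZ.
have mf := mCc Cf.
have -> : (sq (fun x => (c * f x - c * g x)%R) = (c ^+ 2)%:E * sq (fun x => (f x - g x)%R))%E.
  rewrite -ge0_integralZl//; [|by apply: msq; exact: measurable_funB|by move=> x _; rewrite lee_fin sqr_ge0|by rewrite lee_fin ltW].
  by apply: eq_integral => x _; rewrite -EFinM -mulrBr exprMn.
by rewrite (_ : e = c ^+ 2 * (e / c ^+ 2)) ?EFinM ?lee_pmul2l//; field.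
Qed.

Let closure2D g h : closure2 g -> closure2 h -> closure2 (fun x => g x + h x).
Proof.
move=> [mg hg] [mh hh]; split; first exact: measurable_funD.
move=> e e0; have e4 : 0 < e / 4 by lra.
have [f Cf hf] := hg _ e4; have [k Ck hk] := hh _ e4.
have mf := mCc Cf; have mk := mCc Ck.
exists (fun x => f x + k x); first exact: Cc_infty_add.
apply: (sq_le _ _ _ _ hf hk); [exact: measurable_funB|exact: measurable_funB| |].
  by apply: measurable_funB; exact: measurable_funD.
by move=> x _; ring.
Qed.

Let closure2_lim (g : rV -> R) (h : nat -> rV -> R) : measurable_fun Omega g ->
  (forall k, closure2 (h k)) ->
  (forall e : R, 0 < e -> exists k, (sq (fun x => (h k x - g x)%R) <= e%:E)%E) -> closure2 g.
Proof.
move=> mg ch hg; split => // e e0; have e4 : 0 < e / 4 by lra.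
have [k hk] := hg _ e4; have [mh /(_ _ e4)[f Cf hf]] := ch k.
exists f => //; have mf := mCc Cf.
apply: (sq_le _ _ _ _ hf hk); [exact: measurable_funB|exact: measurable_funB|exact: measurable_funB|].
by move=> x _; ring.
Qed.

Import HBNNSimple.

Let closure2_simple (f : {nnsfun rV >-> R}) : closure2 f.
Proof.
have sum N (c : nat -> R) (A : nat -> set rV) : (forall i, measurable (A i)) ->
    closure2 (fun x => \sum_(i < N) c i * \1_(A i) x).
  move=> mA; elim: N => [|N IH].
    under eq_fun do rewrite big_ord0.
    by have := closure2_indic measurable0; rewrite indic0.
  under eq_fun do rewrite big_ord_recr /=.
  by apply: closure2D => //; apply: closure2Z; apply: closure2_indic.
have fE := funext (fimfunEord f); rewrite fE.
by apply: (sum _ (fun i => _) (fun i => f @^-1` [set _])) => i.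
Qed.

Let closure2_ge0 (g : rV -> R) : measurable_fun Omega g -> (forall x, 0 <= g x) ->
  (sq g < +oo)%E -> closure2 g.
Proof.
move=> mg g0 goo.
have mgE : measurable_fun Omega (EFin \o g) by exact/measurable_EFinP.
have [|h [hnd hcv]] := approximation mO mgE; first by move=> x _; rewrite lee_fin.
have cvh x : Omega x -> h k x @[k --> \oo] --> g x.
  by move=> Ox; have /fine_cvgP[_] := hcv x Ox.
have hle k x : Omega x -> h k x <= g x.
  move=> Ox; have := cvh x Ox => hx.
  rewrite -(cvg_lim (@Rhausdorff R) hx); apply: nondecreasing_cvgn_le.
    by move=> i j ij; exact: (lefP _ _ (hnd i j ij)).
  by apply/cvg_ex; exists (g x).
apply: (closure2_lim mg (fun k => closure2_simple (h k))) => e e0.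
have mh k : measurable_fun Omega (h k) by exact: measurable_funTS.
have [] := @dominated_convergence _ _ _ mu Omega mO
  (fun k x => ((h k x - g x) ^+ 2)%:E) (cst 0%E) (fun x => (g x ^+ 2)%:E).
- by move=> k; apply: msq; exact: measurable_funB.
- exact: measurable_cst.
- apply: aeW => x Ox; apply/cvg_EFin; first exact: nearW.
  rewrite -(_ : (g x - g x) ^+ 2 = 0); last by rewrite subrr expr0n.
  by apply: cvgM; apply: cvgB => //; [exact: cvh|exact: cvg_cst|exact: cvh|exact: cvg_cst].
- apply/integrableP; split; first exact: msq.
  by under eq_integral => x _ do rewrite gee0_abs ?lee_fin ?sqr_ge0//.
- apply: aeW => x k Ox; rewrite gee0_abs ?lee_fin ?sqr_ge0//.
  have := hle k x Ox; have hk0 : 0 <= h k x by [].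
  by have := g0 x; nra.
move=> _ _; rewrite integral0 => /fine_cvgP[fin0 /cvgrPdist_le /(_ _ e0) lim0].
near \oo => k; exists k.
have fk : sq (fun x => (h k x - g x)%R) \is a fin_num by near: k.
have : `|0 - fine (sq (fun x => (h k x - g x)%R))| <= e by near: k.
by rewrite sub0r normrN => h1; rewrite -(fineK fk) lee_fin (le_trans _ h1)// ler_norm.
Unshelve. all: by end_near. Qed.

Lemma Cc_infty_dense_square (g : rV -> R) : measurable_fun Omega g -> (sq g < +oo)%E ->
  forall e : R, 0 < e -> exists2 f, Cc_infty Omega f &
    (sq (fun x => (f x - g x)%R) <= e%:E)%E.
Proof.
move=> mg goo.
suff : closure2 g by case.
have mp : measurable_fun Omega (fun x => Num.max (g x) 0) by exact: measurable_maxr.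
have mn : measurable_fun Omega (fun x => Num.max (- g x) 0).
  by apply: measurable_maxr => //; exact: measurableT_comp.
have sub (k : rV -> R) : measurable_fun Omega k -> (forall x, k x ^+ 2 <= g x ^+ 2) -> (sq k < +oo)%E.
  move=> mk kg; apply: le_lt_trans goo; apply: ge0_le_integral => //.
  - by move=> x _; rewrite lee_fin sqr_ge0.
  - exact: msq.
  - exact: msq.
  by move=> x _; rewrite lee_fin.
rewrite (_ : g = fun x => Num.max (g x) 0 + (- 1) * Num.max (- g x) 0); last first.
  by apply/funext => x; case: (leP (g x) 0) => h; case: (leP (- g x) 0) => h'; lra.
apply: closure2D; last apply: closure2Z; apply: closure2_ge0 => //.
- by move=> x; rewrite le_max lexx orbT.
- by apply: sub => // x; case: (leP (g x) 0) => h //; rewrite expr0n sqr_ge0.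
- by move=> x; rewrite le_max lexx orbT.
- by apply: sub => // x; case: (leP (- g x) 0) => h; rewrite ?expr0n ?sqr_ge0// sqrrN.
Qed.

End dense_square_integrable.

(** * The scalar product of L^2 *)

Section L2_scalar_product.
Variables (R : realType) (n : nat) (Omega : set 'rV[R]_n.+1).
Local Notation rV := 'rV[R]_n.+1.
Local Notation mu := (leb R n.+1).
Hypothesis mO : measurable Omega.
Implicit Types f g h : rV -> R.

Definition sqint f : \bar R := (\int[mu]_(x in Omega) ((f x) ^+ 2)%:E)%E.

Definition ip f g : R := \int[mu]_(x in Omega) (f x * g x).

Lemma L2norm_poweR f : (L2norm Omega f `^ 2 = sqint f)%E.
Proof.
rewrite /L2norm poweR_Lnorm ?pnatr_eq0// /sqint [RHS]integral_mkcond.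
apply: eq_integral => x _; rewrite /= patchE /patch; case: ifPn => _ /=.
  by rewrite powR_mulrn// real_normK// num_real.
by rewrite normr0 powR0// pnatr_eq0.
Qed.

(** Both sides of the dichotomy compare the norm with the integral of the
    square, so finiteness and smallness pass from one to the other. *)
Lemma L2norm_sqint f : (L2norm Omega f = +oo /\ sqint f = +oo)%E \/
  exists r : R, [/\ 0 <= r, L2norm Omega f = r%:E & sqint f = (r ^+ 2)%:E].
Proof.
have := L2norm_poweR f; have : (0 <= L2norm Omega f)%E by exact: Lnorm_ge0.
case: (L2norm Omega f) => [r| |]//=; rewrite ?lee_fin => r0 <-.
  by right; exists r; rewrite powR_mulrn.
by left; split=> //; rewrite pnatr_eq0.
Qed.

Lemma L2P f : L2 Omega f <-> measurable_fun Omega f /\ (sqint f < +oo)%E.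
Proof.
rewrite /L2; split => -[mf h]; split => //.
  by have [[h1 _]|[r [_ _ ->]]] := L2norm_sqint f; [rewrite h1 in h|rewrite ltry].
by have [[_ h1]|[r [_ -> _]]] := L2norm_sqint f; [rewrite h1 in h|rewrite ltry].
Qed.

Let msq f : measurable_fun Omega f -> measurable_fun Omega (fun x => (f x ^+ 2)%:E).
Proof. by move=> mf; apply/measurable_EFinP; exact: measurable_funX. Qed.

Let integrable_sq f : L2 Omega f -> mu.-integrable Omega (fun x => (f x ^+ 2)%:E).
Proof.
move=> /L2P[mf foo]; apply/integrableP; split; first exact: msq.
by under eq_integral => x _ do rewrite gee0_abs ?lee_fin ?sqr_ge0//.
Qed.

Lemma L2_integrable_mul f g : L2 Omega f -> L2 Omega g ->
  mu.-integrable Omega (EFin \o (fun x => f x * g x)).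
Proof.
move=> Lf Lg; have [[mf _] [mg _]] := (Lf, Lg).
apply: le_integrable (integrableD mO (integrable_sq Lf) (integrable_sq Lg)) => //.
  by apply/measurable_EFinP; exact: measurable_funM.
move=> x Ox /=; rewrite lee_fin [leRHS]ger0_norm ?addr_ge0 ?sqr_ge0// ler_norml.
have := sqr_ge0 (f x - g x); have := sqr_ge0 (f x + g x).
by have := sqr_ge0 (f x); have := sqr_ge0 (g x); move=> *; apply/andP; split; nra.
Qed.

Lemma L2_linear (c : R) f g : L2 Omega f -> L2 Omega g -> L2 Omega (c *: f + g).
Proof.
move=> Lf Lg; have [[mf _] [mg _]] := (Lf, Lg).
have mcf : measurable_fun Omega (c *: f + g).
  by apply: measurable_funD => //; exact: measurable_funM.
apply/L2P; split => //.
have i := integrableD mO (integrableZl mO (2 * c ^+ 2) (integrable_sq Lf))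
  (integrableZl mO 2 (integrable_sq Lg)).
have /integrableP[_] : mu.-integrable Omega (fun x => ((c *: f + g) x ^+ 2)%:E).
  apply: le_integrable i => //; first exact: msq.
  move=> x Ox /=; rewrite lee_fin !ger0_norm ?sqr_ge0//; last first.
    by rewrite addr_ge0// mulr_ge0 ?sqr_ge0// mulr_ge0// sqr_ge0.
  rewrite [X in X ^+ 2](_ : _ = c * f x + g x)//.
  by have := sqr_ge0 (c * f x - g x); nra.
apply: le_lt_trans; apply: ge0_le_integral => //.
- by move=> x _; rewrite lee_fin sqr_ge0.
- exact: msq.
- by apply: measurableT_comp => //; exact: (msq mcf).
- by move=> x _; rewrite /= lee_fin ler_norm.
Qed.

Lemma L2B f g : L2 Omega f -> L2 Omega g -> L2 Omega (f - g).
Proof. by move=> Lf Lg; rewrite addrC -scaleN1r; exact: L2_linear. Qed.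

Lemma ipC f g : ip f g = ip g f.
Proof. by apply: eq_Rintegral => x _; rewrite mulrC. Qed.

Lemma ip_linear (c : R) f g h : L2 Omega f -> L2 Omega g -> L2 Omega h ->
  ip (c *: f + g) h = c * ip f h + ip g h.
Proof.
move=> Lf Lg Lh; rewrite /ip -RintegralZl//; last exact: L2_integrable_mul.
rewrite -RintegralD//; last exact: L2_integrable_mul.
- by apply: eq_Rintegral => x _; rewrite mulrA -mulrDl.
- have := integrableZl mO c (L2_integrable_mul Lf Lh).
  by apply: eq_integrable => // x _; rewrite /= EFinM.
Qed.

Lemma ip_ge0 f : 0 <= ip f f.
Proof. by apply: Rintegral_ge0 => x _; rewrite -expr2 sqr_ge0. Qed.

Lemma ip_sqint f : L2 Omega f -> (ip f f)%:E = sqint f.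
Proof.
move=> Lf; rewrite /ip /Rintegral fineK//; last first.
  by apply: integrable_fin_num => //; exact: L2_integrable_mul.
Qed.

Lemma L2norm_lt f (e : R) : L2 Omega f -> 0 < e -> ip f f < e ^+ 2 ->
  (L2norm Omega f < e%:E)%E.
Proof.
move=> Lf e0; rewrite -lte_fin ip_sqint//.
have [[_ ->]//|[r [r0 -> ->]]] := L2norm_sqint f; rewrite !lte_fin => h.
by rewrite ltNge; apply/negP => er; move: h; rewrite ltNge lerXn2r ?nnegrE// ltW.
Qed.

Lemma ip_L2norm f : L2 Omega f -> ip f f = (fine (L2norm Omega f)) ^+ 2.
Proof.
move=> Lf; apply/EFin_inj; rewrite ip_sqint//.
have [[_ h]|[r [r0 -> ->]]//] := L2norm_sqint f.
by have /L2P[_] := Lf; rewrite h.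
Qed.

Lemma ip_ae_l f g h : L2 Omega f -> L2 Omega g -> L2 Omega h ->
  {ae mu, forall x, Omega x -> f x = g x} -> ip f h = ip g h.
Proof.
move=> Lf Lg Lh fg; rewrite /ip /Rintegral; congr fine.
have [[[mf _] [mg _]] [mh _]] := (Lf, Lg, Lh).
apply: ae_eq_integral => //.
- by apply/measurable_EFinP; exact: measurable_funM.
- by apply/measurable_EFinP; exact: measurable_funM.
- by apply: filterS fg => x fgx Ox /=; rewrite fgx.
Qed.

Lemma cauchy_schwarz_ip f g : L2 Omega f -> L2 Omega g ->
  `|ip f g| <= fine (L2norm Omega f) * fine (L2norm Omega g).
Proof.
move=> Lf Lg.
have a0 : 0 <= fine (L2norm Omega f) by rewrite fine_ge0// Lnorm_ge0.
have b0 : 0 <= fine (L2norm Omega g) by rewrite fine_ge0// Lnorm_ge0.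
have := ip_L2norm Lf; have := ip_L2norm Lg.
move: (fine _) b0 => b b0; move: (fine _) a0 => a a0 gb fa.
have quad (c : R) : 0 <= a ^+ 2 + 2 * c * ip f g + c ^+ 2 * b ^+ 2.
  have := ip_ge0 (c *: g + f).
  have Ls := L2_linear c Lg Lf.
  rewrite ip_linear// (ipC f) (ipC g (_ + _)) !ip_linear// fa gb.
  by rewrite (ipC g f); lra.
have := discriminant (sqr_ge0 b) (sqr_ge0 a) quad.
by rewrite -exprMn -real_normK ?num_real// ler_pXn2r ?nnegrE// mulr_ge0.
Qed.

End L2_scalar_product.

(** * Fubini's theorem and Gram kernels in two times *)

Section real_fubini.
Context d1 d2 (T1 : measurableType d1) (T2 : measurableType d2) (R : realType).
Variable m1 : {sigma_finite_measure set T1 -> \bar R}.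
Variable m2 : {sigma_finite_measure set T2 -> \bar R}.
Implicit Types (A : set T1) (B : set T2).

Lemma Rintegral_fubini1 (f : T1 * T2 -> R) :
  (m1 \x m2)%E.-integrable setT (EFin \o f) ->
  \int[m1]_x \int[m2]_y f (x, y) = \int[(m1 \x m2)%E]_p f p.
Proof.
move=> fi; rewrite /Rintegral -(integral12_prod_meas1 fi); congr fine.
have ai := integrable_ae measurableT (integrable_fubini_F fi).
apply: ae_eq_integral => //.
- by apply/measurable_EFinP/measurableT_comp => //; exact: measurable_fubini_F fi.
- exact: measurable_fubini_F fi.
- by apply: filterS ai => x /(_ I) xf _; rewrite /fubini_F fineK.
Qed.

Lemma Rintegral_fubini2 (f : T1 * T2 -> R) :
  (m1 \x m2)%E.-integrable setT (EFin \o f) ->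
  \int[m2]_y \int[m1]_x f (x, y) = \int[(m1 \x m2)%E]_p f p.
Proof.
move=> fi; rewrite /Rintegral -(integral21_prod_meas1 fi); congr fine.
have fG : m2.-integrable setT (fun y => \int[m1]_x (f (x, y))%:E)%E.
  have mf := measurable_int _ fi.
  apply/integrableP; split; first exact: measurable_fubini_G fi.
  have := (integrable21ltyP m1 m2 mf).1 fi; apply: le_lt_trans.
  apply: ge0_le_integral => //.
  - by apply: measurableT_comp => //; exact: measurable_fubini_G fi.
  - by apply: (measurable_fun_fubini_tonelli_G (abse \o (EFin \o f))) => //=; exact: measurableT_comp mf.
  - by move=> y _; apply: le_abse_integral => //; apply: measurableT_comp mf _.
have ai := integrable_ae measurableT fG.
apply: ae_eq_integral => //.
- by apply/measurable_EFinP/measurableT_comp => //; exact: measurable_fubini_G fi.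
- exact: measurable_fubini_G fi.
- by apply: filterS ai => x /(_ I) xf _; rewrite /fubini_G fineK.
Qed.

Lemma Rintegral_fubini_rect A B (f : T1 * T2 -> R) : measurable A -> measurable B ->
  (m1 \x m2)%E.-integrable (A `*` B) (EFin \o f) ->
  \int[m1]_(x in A) \int[m2]_(y in B) f (x, y) = \int[(m1 \x m2)%E]_(p in A `*` B) f p.
Proof.
move=> mA mB fi.
rewrite [RHS]Rintegral_mkcond -Rintegral_fubini1; last first.
  rewrite -restrict_EFin; apply/(integrable_mkcond (EFin \o f)) => //.
  exact: measurableX.
rewrite Rintegral_mkcond; apply: eq_Rintegral => x _; rewrite /patch.
case: ifPn => xA.
  rewrite Rintegral_mkcond; apply: eq_Rintegral => y _; rewrite /patch.
  by congr (if _ then _ else _); rewrite in_setX xA.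
under [RHS]eq_Rintegral => y _ do rewrite in_setX (negbTE xA)/=.
by rewrite Rintegral_cst//= mul0r.
Qed.

Lemma Rintegral_fubini_rect2 A B (f : T1 * T2 -> R) : measurable A -> measurable B ->
  (m1 \x m2)%E.-integrable (A `*` B) (EFin \o f) ->
  \int[m2]_(y in B) \int[m1]_(x in A) f (x, y) = \int[(m1 \x m2)%E]_(p in A `*` B) f p.
Proof.
move=> mA mB fi.
rewrite [RHS]Rintegral_mkcond -Rintegral_fubini2; last first.
  rewrite -restrict_EFin; apply/(integrable_mkcond (EFin \o f)) => //.
  exact: measurableX.
rewrite Rintegral_mkcond; apply: eq_Rintegral => y _; rewrite /patch.
case: ifPn => yB.
  rewrite Rintegral_mkcond; apply: eq_Rintegral => x _; rewrite /patch.
  by congr (if _ then _ else _); rewrite in_setX yB andbT.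
under [RHS]eq_Rintegral => x _ do rewrite in_setX (negbTE yB) andbF/=.
by rewrite Rintegral_cst//= mul0r.
Qed.

Lemma measurable_Rintegral_rect2 A B (f : T1 * T2 -> R) : measurable A -> measurable B ->
  (m1 \x m2)%E.-integrable (A `*` B) (EFin \o f) ->
  measurable_fun B (fun y => \int[m1]_(x in A) f (x, y)).
Proof.
move=> mA mB fi.
have fi' : (m1 \x m2)%E.-integrable setT (EFin \o (f \_ (A `*` B))).
  rewrite -restrict_EFin; apply/(integrable_mkcond (EFin \o f)) => //.
  exact: measurableX.
have mG : measurable_fun B (fun y => \int[m1]_x (f \_ (A `*` B)) (x, y)).
  by apply: measurable_funTS; apply: measurableT_comp => //; exact: measurable_fubini_G fi'.
apply: eq_measurable_fun mG => y yB.
rewrite [RHS]Rintegral_mkcond; apply: eq_Rintegral => x _; rewrite /patch.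
by congr (if _ then _ else _); rewrite in_setX yB andbT.
Qed.

End real_fubini.

(** The product under a name of its own, which carries the structure of a
    sigma-finite measure, so that a product can be a factor of another one. *)
Section product_sigma_finite.
Context d1 d2 (T1 : measurableType d1) (T2 : measurableType d2) (R : realType).
Variable m1 : {sigma_finite_measure set T1 -> \bar R}.
Variable m2 : {sigma_finite_measure set T2 -> \bar R}.

Definition sprod : set (T1 * T2) -> \bar R := (m1 \x m2)%E.

HB.instance Definition _ := Measure.copy sprod
  (lebesgue_integral_fubini_product_measure1__canonical__measure_function_Measure m1 m2).

HB.instance Definition _ := Measure_isSigmaFinite.Build _ _ _ sprod
  (lebesgue_integral_fubini.product_measure_sigma_finite_subproof m1 m2).

End product_sigma_finite.

Section gram_kernel.
Context d1 d2 (Y : measurableType d1) (X : measurableType d2) (R : realType).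
Variable m : {sigma_finite_measure set Y -> \bar R}.
Variable mu : {sigma_finite_measure set X -> \bar R}.
Implicit Types psi chi : Y * X -> R.

(** Square integrability is expressed by an iterated integral, the form in which
    the energy of a weak solution is known to be finite. *)
Definition square_integrable_over (A : set Y) psi :=
  [/\ measurable_fun setT psi, (forall s p, ~ A s -> psi (s, p) = 0) &
      (\int[m]_s \int[mu]_p ((psi (s, p)) ^+ 2)%:E < +oo)%E].

Definition gram psi chi (z : Y * Y) : R :=
  \int[mu]_p (psi (z.1, p) * chi (z.2, p)).

Local Notation mm := (sprod m m).

Let prod3 psi chi (w : (Y * Y) * X) : R := psi (w.1.1, w.2) * chi (w.1.2, w.2).

Let measurable_11 psi : measurable_fun setT psi ->
  measurable_fun setT (fun w : (Y * Y) * X => psi (w.1.1, w.2)).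
Proof.
move=> mpsi; apply: (measurableT_comp mpsi); apply/measurable_fun_pairP; split.
  exact: (measurableT_comp measurable_fst measurable_fst).
exact: measurable_snd.
Qed.

Let measurable_12 psi : measurable_fun setT psi ->
  measurable_fun setT (fun w : (Y * Y) * X => psi (w.1.2, w.2)).
Proof.
move=> mpsi; apply: (measurableT_comp mpsi); apply/measurable_fun_pairP; split.
  exact: (measurableT_comp measurable_snd measurable_fst).
exact: measurable_snd.
Qed.

Let measurable_sq psi : measurable_fun setT psi ->
  measurable_fun setT (fun s => \int[mu]_p (psi (s, p) ^+ 2)%:E)%E.
Proof.
move=> mpsi; apply: (measurable_fun_fubini_tonelli_F (fun z => (psi z ^+ 2)%:E)).
  by apply/measurable_EFinP; exact: measurable_funX.
by move=> z; rewrite lee_fin sqr_ge0.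
Qed.

Let integrable_sq1 psi (A B : set Y) : measurable B -> (m B < +oo)%E ->
  square_integrable_over A psi ->
  (mm \x mu)%E.-integrable setT
    (fun w => (psi (w.1.1, w.2) ^+ 2 * \1_B w.1.2)%:E).
Proof.
move=> mB Boo [mpsi _ psi_oo].
have sq0 s : (0 <= \int[mu]_p (psi (s, p) ^+ 2)%:E)%E.
  by apply: integral_ge0 => p _; rewrite lee_fin sqr_ge0.
have mf : measurable_fun setT (fun w : (Y * Y) * X => (psi (w.1.1, w.2) ^+ 2 * \1_B w.1.2)%:E).
  apply/measurable_EFinP/measurable_funM.
    by apply: measurable_funX; exact: measurable_11.
  by apply: (measurableT_comp (measurable_indic mB)); exact: (measurableT_comp measurable_snd measurable_fst).
apply: (integrable12ltyP mm mu mf).2 => /=.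
have -> : (\int[mm]_z \int[mu]_p `|(psi (z.1, p) ^+ 2 * \1_B z.2)%:E|)%E
   = (\int[mm]_z ((\int[mu]_p (psi (z.1, p) ^+ 2)%:E) * (\1_B z.2)%:E))%E.
  apply: eq_integral => z _.
  rewrite muleC -ge0_integralZl//; last 2 first.
  - apply/measurable_EFinP/measurable_funX; exact: (measurableT_comp mpsi (measurable_pair1 z.1)).
  - by move=> p _; rewrite lee_fin sqr_ge0.
  apply: eq_integral => p _; rewrite gee0_abs ?lee_fin; last by rewrite mulr_ge0 ?sqr_ge0.
  by rewrite -EFinM mulrC.
rewrite (fubini_tonelli1 (fun z => (\int[mu]_p (psi (z.1, p) ^+ 2)%:E) * (\1_B z.2)%:E)%E)/=; last 2 first.
- apply: emeasurable_funM; first exact: (measurableT_comp (measurable_sq mpsi) measurable_fst).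
  by apply/measurable_EFinP; exact: (measurableT_comp (measurable_indic mB) measurable_snd).
- by move=> z; rewrite mule_ge0 ?lee_fin.
rewrite /fubini_F/=; under eq_integral => s _.
  rewrite ge0_integralZl//; last by apply/measurable_EFinP.
  rewrite integral_indic// setIT; over.
rewrite ge0_integralZr//; last exact: measurable_sq.
by rewrite lte_mul_pinfty// ?integral_ge0// ge0_fin_numE ?integral_ge0.
Qed.

Let integrable_sq2 chi (A B : set Y) : measurable B -> (m B < +oo)%E ->
  square_integrable_over A chi ->
  (mm \x mu)%E.-integrable setT
    (fun w => (chi (w.1.2, w.2) ^+ 2 * \1_B w.1.1)%:E).
Proof.
move=> mB Boo [mpsi _ psi_oo].
have sq0 s : (0 <= \int[mu]_p (chi (s, p) ^+ 2)%:E)%E.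
  by apply: integral_ge0 => p _; rewrite lee_fin sqr_ge0.
have mf : measurable_fun setT (fun w : (Y * Y) * X => (chi (w.1.2, w.2) ^+ 2 * \1_B w.1.1)%:E).
  apply/measurable_EFinP/measurable_funM.
    by apply: measurable_funX; exact: measurable_12.
  by apply: (measurableT_comp (measurable_indic mB)); exact: (measurableT_comp measurable_fst measurable_fst).
apply: (integrable12ltyP mm mu mf).2 => /=.
have -> : (\int[mm]_z \int[mu]_p `|(chi (z.2, p) ^+ 2 * \1_B z.1)%:E|)%E
   = (\int[mm]_z ((\int[mu]_p (chi (z.2, p) ^+ 2)%:E) * (\1_B z.1)%:E))%E.
  apply: eq_integral => z _.
  rewrite muleC -ge0_integralZl//; last 2 first.
  - apply/measurable_EFinP/measurable_funX; exact: (measurableT_comp mpsi (measurable_pair1 z.2)).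
  - by move=> p _; rewrite lee_fin sqr_ge0.
  apply: eq_integral => p _; rewrite gee0_abs ?lee_fin; last by rewrite mulr_ge0 ?sqr_ge0.
  by rewrite -EFinM mulrC.
rewrite (fubini_tonelli2 (fun z => (\int[mu]_p (chi (z.2, p) ^+ 2)%:E) * (\1_B z.1)%:E)%E)/=; last 2 first.
- apply: emeasurable_funM; first exact: (measurableT_comp (measurable_sq mpsi) measurable_snd).
  by apply/measurable_EFinP; exact: (measurableT_comp (measurable_indic mB) measurable_fst).
- by move=> z; rewrite mule_ge0 ?lee_fin.
rewrite /fubini_G/=; under eq_integral => s _.
  rewrite ge0_integralZl//; last by apply/measurable_EFinP.
  rewrite integral_indic// setIT; over.
rewrite ge0_integralZr//; last exact: measurable_sq.
by rewrite lte_mul_pinfty// ?integral_ge0// ge0_fin_numE ?integral_ge0.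
Qed.

(** Since |x y| <= x^2 + y^2, it suffices to integrate each square, over the
    times of [A] or [B] for the variable on which it does not depend. *)
Let integrable_prod3 psi chi (A B : set Y) : measurable A -> measurable B ->
  (m A < +oo)%E -> (m B < +oo)%E ->
  square_integrable_over A psi -> square_integrable_over B chi ->
  (mm \x mu)%E.-integrable setT (EFin \o prod3 psi chi).
Proof.
move=> mA mB Aoo Boo hpsi hchi.
have := integrableD measurableT (integrable_sq1 mB Boo hpsi) (integrable_sq2 mA Aoo hchi).
have [mpsi psiA _] := hpsi; have [mchi chiB _] := hchi.
apply: le_integrable => //.
  by apply/measurable_EFinP/measurable_funM; [exact: measurable_11|exact: measurable_12].
move=> [[s t] p] _ /=; rewrite /prod3/= !lee_fin.
set x := psi (s, p); set y := chi (t, p).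
have nn : 0 <= x ^+ 2 * \1_B t + y ^+ 2 * \1_A s.
  by rewrite addr_ge0// mulr_ge0// sqr_ge0.
rewrite (ger0_norm nn).
have [Bt|Bt] := pselect (B t); last first.
  by rewrite /y chiB// mulr0 normr0; move: nn; rewrite /y chiB.
have [As|As] := pselect (A s); last first.
  by rewrite /x psiA// mul0r normr0; move: nn; rewrite /x psiA.
rewrite !indicE !mem_set//= !mulr1 ler_norml; apply/andP; split.
  by have := sqr_ge0 (x + y); have := sqr_ge0 x; have := sqr_ge0 y; nra.
by have := sqr_ge0 (x - y); have := sqr_ge0 x; have := sqr_ge0 y; nra.
Qed.

Lemma integrable_gram psi chi (A B : set Y) : measurable A -> measurable B ->
  (m A < +oo)%E -> (m B < +oo)%E ->
  square_integrable_over A psi -> square_integrable_over B chi ->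
  (m \x m)%E.-integrable setT (EFin \o gram psi chi).
Proof.
move=> mA mB Aoo Boo hpsi hchi.
have i3 := integrable_prod3 mA mB Aoo Boo hpsi hchi.
have iF := integrable_fubini_F i3.
apply: le_integrable iF => //.
  apply/measurable_EFinP; apply: measurableT_comp => //.
  exact: measurable_fubini_F i3.
move=> z _ /=; rewrite /gram /Rintegral /fubini_F /prod3/=.
by case: (\int[mu]_p _)%E => [r| |]//=; rewrite ?normr0 ?leey.
Qed.

(** By Fubini's theorem, the integral of the kernel is the integral over [p] of
    the square of the integral of [psi (s, p)] in [s]. The latter converges for
    almost every [p] only, so the inner integral is compared with its positive
    part. *)
Lemma gram_ge0 psi (A : set Y) : measurable A -> (m A < +oo)%E ->
  square_integrable_over A psi -> 0 <= \int[(m \x m)%E]_z gram psi psi z.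
Proof.
move=> mA Aoo hpsi.
have i3 := integrable_prod3 mA mA Aoo Aoo hpsi hpsi.
have iF := integrable_fubini_F i3.
have -> : \int[(m \x m)%E]_z gram psi psi z = \int[(mm \x mu)%E]_w prod3 psi psi w.
  exact: (Rintegral_fubini1 i3).
rewrite -Rintegral_fubini2//.
have [mpsi psiA psi_oo] := hpsi.
have isq : (m \x mu)%E.-integrable setT (fun z => (psi z ^+ 2)%:E).
  have mf : measurable_fun setT (fun z => (psi z ^+ 2)%:E).
    by apply/measurable_EFinP/measurable_funX.
  have [_] := @integrable12ltyP _ _ _ _ _ m mu _ mf; apply.
  apply: le_lt_trans psi_oo; rewrite le_eqVlt; apply/orP; left; apply/eqP.
  apply: eq_integral => s _; apply: eq_integral => p _.
  by rewrite gee0_abs// lee_fin sqr_ge0.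
have pos : {ae mu, forall p, 0 <= \int[mm]_z prod3 psi psi (z, p)}.
  apply: filterS2 (ae_integrable2 isq) (ae_integrable2 i3) => p ip i3p.
  rewrite -Rintegral_fubini1//; rewrite /prod3/=.
  have iA : m.-integrable setT (fun s => (\1_A s : R)%:E).
    apply/integrableP; split; first by apply/measurable_EFinP.
    under eq_integral => s _ do rewrite gee0_abs ?lee_fin//.
    by rewrite integral_indic// setIT.
  have ipsi : m.-integrable setT (EFin \o (fun s => psi (s, p))).
    apply: le_integrable (integrableD measurableT ip iA) => //.
      by apply/measurable_EFinP; exact: (measurableT_comp mpsi (measurable_pair2 p)).
    move=> s _ /=; rewrite lee_fin.
    have [As|As] := pselect (A s); last by rewrite psiA// normr0.
    rewrite indicE mem_set//= [leRHS]ger0_norm; last by rewrite addr_ge0// sqr_ge0.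
    by rewrite ler_norml; apply/andP; split; have := sqr_ge0 (psi (s, p) - 1);
      have := sqr_ge0 (psi (s, p) + 1); nra.
  under eq_Rintegral => s _ do rewrite RintegralZl//.
  by rewrite RintegralZr// sqr_ge0.
have mG : measurable_fun setT (fun p => \int[mm]_z prod3 psi psi (z, p)).
  by apply: measurableT_comp => //; exact: measurable_fubini_G i3.
rewrite /Rintegral (ae_eq_integral (fun p => (Num.max 0 (\int[mm]_z prod3 psi psi (z, p)))%:E))//.
- by apply/fine_ge0/integral_ge0 => p _; rewrite lee_fin le_max lexx.
- exact/measurable_EFinP.
- by apply/measurable_EFinP/measurable_maxr.
- by apply: filterS pos => p p0 _; rewrite max_r.
Qed.

(** Multiplication by the indicator of [S] reduces integrals of the kernel over
    rectangles to integrals over all pairs of times. *)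
Let window (S : set Y) psi (z : Y * X) : R := \1_S z.1 * psi z.

Let square_integrable_window (A S : set Y) psi : measurable S ->
  square_integrable_over A psi -> square_integrable_over S (window S psi).
Proof.
move=> mS [mpsi psiA psioo].
have mw : measurable_fun setT (window S psi).
  by apply: measurable_funM => //; exact: (measurableT_comp (measurable_indic mS) measurable_fst).
split; first exact: mw.
  by move=> s p nS; rewrite /window indicE memNset//= mul0r.
apply: le_lt_trans psioo; apply: ge0_le_integral => //.
- by move=> s _; apply: integral_ge0 => p _; rewrite lee_fin sqr_ge0.
- exact: measurable_sq.
- exact: measurable_sq.
move=> s _; apply: ge0_le_integral => //.
- by move=> p _; rewrite lee_fin sqr_ge0.
- by apply/measurable_EFinP/measurable_funX; exact: (measurableT_comp mw (measurable_pair1 s)).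
- by apply/measurable_EFinP/measurable_funX; exact: (measurableT_comp mpsi (measurable_pair1 s)).
move=> p _; rewrite lee_fin /window indicE /=.
by case: (_ \in _); rewrite ?mul1r// mul0r expr0n sqr_ge0.
Qed.

Let gram_window (S S' : set Y) psi chi s t : S s -> S' t ->
  gram (window S psi) (window S' chi) (s, t) = gram psi chi (s, t).
Proof.
move=> Ss St; apply: eq_Rintegral => p _.
by rewrite /window /= !indicE !mem_set//= !mul1r.
Qed.

Lemma integrable_gram_rect psi chi (A B S S' : set Y) :
  square_integrable_over A psi -> square_integrable_over B chi ->
  measurable S -> measurable S' -> (m S < +oo)%E -> (m S' < +oo)%E ->
  (m \x m)%E.-integrable (S `*` S') (EFin \o gram psi chi).
Proof.
move=> hpsi hchi mS mS' Soo S'oo.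
have := integrable_gram mS mS' Soo S'oo (square_integrable_window mS hpsi)
  (square_integrable_window mS' hchi).
move=> /(integrableS measurableT (measurableX mS mS') (@subsetT _ _)).
apply: eq_integrable; first exact: measurableX.
by move=> [s t] /set_mem[/= Ss St]; rewrite /= gram_window.
Qed.

Lemma gram_rect_ge0 psi (A S : set Y) :
  square_integrable_over A psi -> measurable S -> (m S < +oo)%E ->
  0 <= \int[(m \x m)%E]_(z in S `*` S) gram psi psi z.
Proof.
move=> hpsi mS Soo.
have := gram_ge0 mS Soo (square_integrable_window mS hpsi).
congr (_ <= _); rewrite [RHS]Rintegral_mkcond; apply: eq_Rintegral => -[s t] _.
rewrite /patch; case: ifPn => [/set_mem[/= Ss St]|nS]; first by rewrite gram_window.
rewrite /gram /= /Rintegral integral0_eq// => p _; rewrite /window/= !indicE.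
move: nS; rewrite in_setX negb_and => /orP[|] /negbTE/= ->; by rewrite ?mul0r ?mulr0.
Qed.

End gram_kernel.

(** * Functions of two times *)

Section interval_integrals.
Variable R : realType.
Implicit Types (g h : R -> R) (a b c : R).
Local Notation mu := (@lebesgue_measure R).
Local Notation J g a b := (\int[mu]_(x in `]a, b[) g x).

Lemma integrable_oo_continuous g a b : continuous g ->
  mu.-integrable `]a, b[ (EFin \o g).
Proof.
move=> cg; have : mu.-integrable `[a, b] (EFin \o g); last first.
  by apply: integrableS => //; exact: subset_itv_oo_cc.
apply: continuous_compact_integrable; first exact: segment_compact.
exact: continuous_subspaceT.
Qed.

Lemma Rintegral_oo_cst c a b : a <= b -> J (cst c) a b = c * (b - a).
Proof.
move=> ab; rewrite /cst Rintegral_cst//= lebesgue_measure_itv/= lte_fin.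
case: ltP => [//|ba].
by rewrite (_ : b = a) ?subrr ?mulr0//; lra.
Qed.

Lemma Rintegral_oo_mean g a b c e : continuous g -> a <= b ->
  (forall x, a < x < b -> `|g x - c| <= e) -> `|J g a b - c * (b - a)| <= e * (b - a).
Proof.
move=> cg ab gc; rewrite -(Rintegral_oo_cst c ab) -RintegralB//; last 2 first.
- exact: integrable_oo_continuous.
- by apply: integrable_oo_continuous; exact: cst_continuous.
have ci : continuous (fun x => g x - cst c x).
  by move=> x; apply: cvgB => //; [exact: cg|exact: cvg_cst].
apply: le_trans; first by apply: le_normr_Rintegral => //; exact: integrable_oo_continuous.
rewrite -(Rintegral_oo_cst e ab); apply: le_Rintegral => //.
- apply: integrable_oo_continuous => x; apply: cvg_norm; exact: ci.
- by apply: integrable_oo_continuous; exact: cst_continuous.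
Qed.

Lemma Rintegral_oo_cat g a b c : continuous g -> a <= b -> b <= c ->
  J g a c = J g a b + J g b c.
Proof.
move=> cg ab bc.
have i := integrable_oo_continuous.
have oc u v : J g u v = \int[mu]_(x in `]u, v]) g x by rewrite Rintegral_itv_bndo_bndc//; exact: i.
rewrite !oc -(@Rintegral_itvB _ _ (BRight a) (BRight c) b) ?bnd_simp//; first by rewrite addrC subrK.
have : mu.-integrable `[a, c] (EFin \o g); last first.
  by apply: integrableS => //; exact: subset_itv_oc_cc.
apply: continuous_compact_integrable; first exact: segment_compact.
exact: continuous_subspaceT.
Qed.

(** The values are the limits of the means over short intervals ending at [b];
    the shift [s] serves to compare functions of different variables. *)
Lemma eq_from_Rintegral_oo g h s a b : continuous g -> continuous h -> a < b ->
  (forall x, a <= x <= b -> J g x b = J h (s + x) (s + b)) -> g b = h (s + b).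
Proof.
move=> cg ch ab gh; apply/eqP; rewrite -subr_eq0; apply/eqP/eqP.
rewrite -normr_le0; apply/ler_addgt0Pr => e e0; rewrite add0r.
have e2 : 0 < e / 2 by lra.
have /cvgrPdist_le/(_ _ e2)[d1 /= d10 hd1] := cg b.
have /cvgrPdist_le/(_ _ e2)[d2 /= d20 hd2] := ch (s + b).
pose d := Num.min (b - a) (Num.min d1 d2).
have d0 : 0 < d by rewrite !lt_min; apply/and3P; split => //; lra.
have [dab dd1 dd2] : [/\ d <= b - a, d <= d1 & d <= d2].
  by rewrite !ge_min !lexx !orbT.
pose x := b - d.
have m1 : `|J g x b - g b * (b - x)| <= e / 2 * (b - x).
  apply: Rintegral_oo_mean => //; first by rewrite /x; lra.
  move=> y xy; rewrite distrC; apply: hd1 => /=; rewrite ger0_norm; rewrite /x in xy; lra.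
have m2 : `|J h (s + x) (s + b) - h (s + b) * (s + b - (s + x))| <= e / 2 * (s + b - (s + x)).
  apply: Rintegral_oo_mean => //; first by rewrite /x; lra.
  move=> y xy; rewrite distrC; apply: hd2 => /=; rewrite ger0_norm; rewrite /x in xy; lra.
have xab : a <= x <= b by rewrite /x; lra.
rewrite -gh// in m2.
have sxb : s + b - (s + x) = d by rewrite /x; ring.
have xb : b - x = d by rewrite /x; ring.
move: m1 m2; rewrite sxb xb !ler_norml => /andP[? ?] /andP[? ?].
by apply/andP; split; rewrite -(ler_pM2r d0); lra.
Qed.

(** [G] is a primitive on ]-L, L[, extended by constants so as to be continuous
    everywhere. The affine change of variables is part of the statement because
    the integrals of [short_time_bound] are all of that form. *)
Lemma Rintegral_oo_antiderivative g L : continuous g -> 0 < L -> exists G : R -> R,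
  continuous G /\ forall al be d, be != 0 -> 0 <= d ->
     - L < al < L -> - L < al + be * d < L ->
     J (fun x => g (al + be * x)) 0 d = (G (al + be * d) - G al) / be.
Proof.
move=> cg L0; pose G x := \int[mu]_(t in `[- L - 1, x]) g t.
have dG x : - L - 1 < x < L + 1 -> is_derive x 1 G (g x).
  move=> /andP[x1 x2].
  have [] := @continuous_FTC1 _ g (BLeft (- L - 1)) x (L + 1) x2.
  - by apply: continuous_compact_integrable; [exact: segment_compact|exact: continuous_subspaceT].
  - exact: x1.
  - exact: cg.
  - by move=> dvG dGE; apply: DeriveDef; [exact: dvG|rewrite -derive1E; exact: dGE].
have dGc x : - L - 1 < x < L + 1 -> {for x, continuous G}.
  by move=> /dG dGx; apply: differentiable_continuous; apply/derivable1_diffP; exact: ex_derive.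
pose cl x := Num.max (- L) (Num.min L x).
have cl_id x : - L < x < L -> cl x = x.
  by move=> /andP[x1 x2]; rewrite /cl min_r ?max_r ?ltW.
have cl_in x : - L - 1 < cl x < L + 1.
  rewrite /cl lt_max gt_max gt_min; apply/andP; split; first by apply/orP; left; lra.
  by apply/andP; split; [lra|apply/orP; left; lra].
exists (G \o cl); split.
  move=> x; apply: continuous_comp; last exact: dGc.
  by apply: continuous_max; [exact: cst_continuous|apply: continuous_min; [exact: cst_continuous|]].
move=> al be d be0 d0 aL bL; rewrite /= !cl_id//.
have [->|dn0] := eqVneq d 0.
  by rewrite set_itvoo0 Rintegral_set0 mulr0 addr0 subrr mul0r.
have {dn0}d0 : 0 < d by rewrite lt_neqAle eq_sym dn0.
have cf : continuous (fun x => g (al + be * x)).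
  move=> x; apply: (@continuous_comp _ _ _ (fun x => al + be * x)); last exact: cg.
  by apply: cvgD; [exact: cvg_cst|apply: cvgMr; exact: cvg_id].
have inL x : 0 <= x <= d -> - L - 1 < al + be * x < L + 1.
  move=> xd; have [be1|be1] := leP 0 be.
    have h1 : 0 <= be * x <= be * d by apply/andP; split; nra.
    by lra.
  have h1 : be * d <= be * x <= 0 by apply/andP; split; nra.
  by lra.
pose F : R -> R := be^-1 \*: (G \o (fun x => al + be * x)).
have dF x : 0 <= x <= d -> is_derive x 1 F (g (al + be * x)).
  move=> xd.
  have da : is_derive x 1 (fun x => al + be * x) be.
    by apply: is_derive_eq; rewrite add0r mul1r; exact: mulr1.
  have dGa := dG _ (inL _ xd).
  have dc := @is_derive1_comp R G (fun x => al + be * x) x _ _ dGa da.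
  have := @is_deriveZ _ _ _ _ be^-1 x 1 _ dc.
  by rewrite /GRing.scale/= mulrCA mulVf ?mulr1.
have cF x : 0 <= x <= d -> {for x, continuous F}.
  by move=> /dF dFx; apply: differentiable_continuous; apply/derivable1_diffP; exact: ex_derive.
have FTC := @continuous_FTC2 _ (fun x => g (al + be * x)) F 0 d d0.
rewrite Rintegral_itv_bndo_bndc; last exact: integrable_oo_continuous.
rewrite Rintegral_itv_obnd_cbnd; last first.
  have : mu.-integrable `[0, d] (EFin \o (fun x => g (al + be * x))); last first.
    by apply: integrableS => //; exact: subset_itv_oc_cc.
  apply: continuous_compact_integrable; first exact: segment_compact.
  exact: continuous_subspaceT.
rewrite /Rintegral FTC.
- by rewrite -EFinB /= /F /= mulr0 addr0 /GRing.scale/= -mulrBr mulrC.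
- exact: continuous_subspaceT.
- split.
  + move=> x; rewrite in_itv/= => xd; have xd' : 0 <= x <= d by lra.
    by have dFx := dF _ xd'; exact: ex_derive.
  + apply: cvg_at_right_filter; apply: cF; lra.
  + apply: cvg_at_left_filter; apply: cF; lra.
- move=> x; rewrite in_itv/= => xd; rewrite derive1E.
  have xd' : 0 <= x <= d by lra.
  by have dFx := dF _ xd'; exact: derive_val.
Qed.

End interval_integrals.

Section two_times.
Variable R : realType.
Local Notation mu := (@lebesgue_measure R).
Local Notation J g a b := (\int[mu]_(x in `]a, b[) g x).

(** The derivative is 0 at each point. Constant extension outside [0, b], by
    the clamp [cl], makes this a statement about the whole line. *)
Lemma eq_of_small_increments (D : R -> R) (b : R) : 0 <= b ->
  (forall x e, 0 <= x <= b -> 0 < e -> exists2 d, 0 < d & forall y, 0 <= y <= b ->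
     `|y - x| < d -> `|D y - D x| <= e * `|y - x|) -> D b = D 0.
Proof.
move=> b0 hD; pose cl x := Num.max 0 (Num.min b x).
have cl_in x : 0 <= cl x <= b.
  by rewrite /cl le_max lexx/= ge_max b0/= ge_min lexx.
have cl_lip x y : `|cl y - cl x| <= `|y - x|.
  have cases z : [\/ z <= 0 /\ cl z = 0, 0 <= z <= b /\ cl z = z | b <= z /\ cl z = b].
    have [z0|z0] := leP z 0; first by constructor 1; rewrite /cl min_r ?max_l//; lra.
    have [zb|zb] := leP z b; last by constructor 3; rewrite /cl min_l ?max_r//; lra.
    by constructor 2; rewrite /cl min_r ?max_r//; lra.
  have [yx|yx] := leP x y.
    rewrite (ger0_norm (x := y - x)) ?subr_ge0// ler_norml.
    by case: (cases x) => [] [? ->]; case: (cases y) => [] [? ->]; apply/andP; split; lra.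
  rewrite (ltr0_norm (x := y - x)) ?subr_lt0// ler_norml.
  by case: (cases x) => [] [? ->]; case: (cases y) => [] [? ->]; apply/andP; split; lra.
have clb : cl b = b by rewrite /cl minxx max_r.
have cl0 : cl 0 = 0 by rewrite /cl min_r// maxxx.
rewrite -{1}clb -{1}cl0; apply: (@is_derive_0_is_cst _ (D \o cl)) => x.
have lim0 : (fun h : R => h^-1 *: ((D \o cl) (h *: (1 : R) + x) - (D \o cl) x)) @ 0^' --> (0 : R).
  apply/cvgrPdist_le => e e0.
  have [d d0 hd] := hD (cl x) e (cl_in x) e0.
  near=> h.
  have h0 : h != 0 by near: h; exact: nbhs_dnbhs_neq.
  have hd' : `|h| < d by near: h; apply: dnbhs0_lt.
  rewrite sub0r normrN normrM normfV ler_pdivrMl ?normr_gt0// mulrC.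
  have hx := cl_lip x (h *: (1 : R) + x).
  have hh : h *: (1 : R) + x - x = h by rewrite addrK; exact: mulr1.
  rewrite hh in hx.
  apply: (le_trans (hd _ (cl_in _) (le_lt_trans hx hd'))).
  by rewrite ler_pM2l.
apply: DeriveDef; first by apply/cvg_ex; exists 0.
by apply/cvg_lim => //; exact: Rhausdorff.
Unshelve. all: by end_near. Qed.

Variables (T : R) (F : R -> R -> R).
Hypotheses (cF : continuous (fun p : R * R => F p.1 p.2))
  (closed_form : forall s t, 0 <= s <= T -> 0 <= t <= T ->
    J (fun r => F 0 r - F s r) 0 t = J (fun r => F r 0 - F r t) 0 s).

Let cF1 t : continuous (F^~ t).
Proof.
by move=> s; apply: continuous2_cvg; [exact: (@cF (s, t))|exact: cvg_id|exact: cvg_cst].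
Qed.

Let cF2 s : continuous (F s).
Proof.
by move=> t; apply: continuous2_cvg; [exact: (@cF (s, t))|exact: cvg_cst|exact: cvg_id].
Qed.

(** The hypothesis says that the form F (ds + dt) is closed. Its primitive
    [Psi] satisfies d_s Psi = d_t Psi = F, so it is constant along antidiagonals,
    and F is a function of s + t. *)
Lemma function_of_sum s t : 0 <= s -> 0 <= t -> s + t <= T -> F s t = F (s + t) 0.
Proof.
have exch (x y z w : R) : x - y = z - w -> z + y = x + w by lra.
pose Psi s t := J (F^~ 0) 0 s + J (F s) 0 t.
have PsiD u v : Psi u v = J (F^~ 0) 0 u + J (F u) 0 v by [].
clearbody Psi.
have PsiE u v : 0 <= u <= T -> 0 <= v <= T -> Psi u v = J (F 0) 0 v + J (F^~ v) 0 u.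
  move=> uT vT; have := closed_form uT vT.
  rewrite !RintegralB//; try exact: integrable_oo_continuous.
  by rewrite PsiD; exact: exch.
have Psi_anti u v : 0 <= u -> 0 <= v -> u + v <= T -> Psi u v = Psi (u + v) 0.
  move=> u0 v0 uvT; pose b := u + v; rewrite -/b.
  (* [D] is the restriction of [Psi] to the antidiagonal through (u, v). *)
  pose D x := Psi x (b - x).
  have DE x : D x = Psi x (b - x) by [].
  clearbody D.
  have small x e : 0 <= x <= b -> 0 < e -> exists2 d, 0 < d & forall y, 0 <= y <= b ->
     `|y - x| < d -> `|D y - D x| <= e * `|y - x|.
    move=> xb e0.
    have /cvgrPdist_le/(_ (e / 2)) := @cF (x, b - x).
    have e2 : 0 < e / 2 by lra.
    move=> /(_ e2)[[A B] /= [[d1 /= d10 hA] [d2 /= d20 hB]] AB].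
    exists (Num.min d1 d2) => [|y yb]; first by rewrite lt_min d10.
    rewrite lt_min => /andP[yd1 yd2].
    have close r r' : `|r - x| <= `|y - x| -> `|r' - (b - x)| <= `|y - x| ->
        `|F r r' - F x (b - x)| <= e / 2.
      move=> h1 h2; rewrite distrC; apply: (AB (r, r')); split => /=.
        by apply: hA => /=; rewrite distrC; apply: le_lt_trans yd1.
      by apply: hB => /=; rewrite distrC; apply: le_lt_trans yd2.
    (* Every step from (p, b - p) to (q, b - q) with p <= q goes through
       the corner (p, b - q), and each half is the integral of F over a segment. *)
    have step p q : 0 <= p -> p <= q -> q <= b ->
        (forall r, p <= r <= q -> `|r - x| <= `|y - x|) -> q - p = `|y - x| ->
        `|D q - D p| <= e * `|y - x|.
      move=> p0 pq qb near_x qp.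
      have -> : D q - D p = J (F^~ (b - q)) p q - J (F p) (b - q) (b - p).
        rewrite !DE (PsiE q)//; [|rewrite /b in qb *; lra..].
        rewrite (Rintegral_oo_cat (@cF1 (b - q)) p0 pq).
        rewrite addrA -(PsiE p); [|rewrite /b in qb *; lra..].
        rewrite !PsiD (@Rintegral_oo_cat _ (F p) 0 (b - q) (b - p)) //; try lra.
      set c := F x (b - x) in close.
      have m1 : `|J (F^~ (b - q)) p q - c * (q - p)| <= e / 2 * (q - p).
        apply: Rintegral_oo_mean => // r rpq; apply: close; first by apply: near_x; lra.
        rewrite (_ : b - q - (b - x) = - (q - x)) ?normrN; last by ring.
        by apply: near_x; lra.
      have m2 : `|J (F p) (b - q) (b - p) - c * (b - p - (b - q))| <= e / 2 * (b - p - (b - q)).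
        apply: Rintegral_oo_mean => //; first by lra.
        move=> r rpq; apply: close; first by apply: near_x; lra.
        rewrite (_ : r - (b - x) = - ((b - r) - x)) ?normrN; last by ring.
        by apply: near_x; lra.
      have qpb : b - p - (b - q) = `|y - x| by lra.
      rewrite qpb in m2; rewrite qp in m1.
      move: m1 m2; rewrite !ler_norml => /andP[? ?] /andP[? ?].
      by apply/andP; split; lra.
    have [xy|yx] := leP x y.
      apply: step => //; try lra; last by rewrite ger0_norm//; lra.
      by move=> r xry; rewrite !ger0_norm; lra.
    rewrite distrC; apply: step => //; try lra; last by rewrite ler0_norm; lra.
    by move=> r xry; rewrite !ler0_norm; lra.
  have b0 : 0 <= b by rewrite /b addr_ge0.
  have DbE := eq_of_small_increments b0 small.
  have ub : 0 <= u by [].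
  have small_u x e : 0 <= x <= u -> 0 < e -> exists2 d, 0 < d & forall y, 0 <= y <= u ->
     `|y - x| < d -> `|D y - D x| <= e * `|y - x|.
    move=> xu e0; have [||d d0 hd] := small x e; rewrite /b; [lra|by []|].
    by exists d => // y yu; apply: hd; rewrite /b; lra.
  have DuE := eq_of_small_increments u0 small_u.
  have -> : Psi u v = D u by rewrite DE /b addrC addKr.
  by rewrite DuE -DbE DE subrr.
move=> s0; rewrite le_eqVlt => /predU1P[<- _|t0 stT]; first by rewrite addr0.
apply: (@eq_from_Rintegral_oo _ (F s) (F^~ 0) s 0 t) => // x xt.
have J00 (g : R -> R) : J g 0 0 = 0 by rewrite set_itvoo0 Rintegral_set0.
have PE v : 0 <= v <= t -> J (F s) 0 v = J (F^~ 0) s (s + v).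
  move=> vt; have := Psi_anti s v s0; rewrite !PsiD J00 addr0.
  rewrite (@Rintegral_oo_cat _ (F^~ 0) 0 s (s + v))//; last by lra.
  move=> h; have : 0 <= v by lra.
  by move=> /h; lra.
have xle : 0 <= x by lra.
have h1 := PE x; have h2 := PE t; move: h1 h2.
rewrite (@Rintegral_oo_cat _ (F s) 0 x t)//; [|lra..].
rewrite (@Rintegral_oo_cat _ (F^~ 0) s (s + x) (s + t))//; [|lra..].
by move=> h1 h2; have := h1 ltac:(lra); have := h2 ltac:(lra); lra.
Qed.

End two_times.

Section energy_bound.
Variable R : realType.
Local Notation mu := (@lebesgue_measure R).
Local Notation J g a b := (\int[mu]_(x in `]a, b[) g x).

Lemma le_Rintegral_oo (f g : R -> R) a b : continuous f -> continuous g ->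
  (forall x, a < x < b -> f x <= g x) -> J f a b <= J g a b.
Proof.
move=> cf cg fg; apply: le_Rintegral => //; try exact: integrable_oo_continuous.
Qed.

(** [h (2 t)] is the squared norm of the solution at time [t], and the last
    hypothesis is the energy inequality integrated over the square
    ]0, d[ x ]0, d[; the convexity of [h] turns it into a pointwise bound.
    Let A and B be the integrals of [h] over ]0, d[ and ]d, 2d[. By convexity,
    A <= (d h(0) + (A + B) / 2) / 2 and d h(d) <= (A + B) / 2, and the energy
    inequality gives B - A <= M d (A + B) / 2, at most (A + B) / 5. Eliminating A
    and B leaves h(d) <= 5/3 h(0). *)
Lemma short_time_bound (h : R -> R) (M d : R) : continuous h -> 0 < d ->
  0 <= M -> M * d <= 2 / 5 ->
  (forall t, 0 <= t <= d -> 0 <= h (2 * t)) ->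
  (forall s t, 0 <= s <= d -> 0 <= t <= d -> h (s + t) <= (h (2 * s) + h (2 * t)) / 2) ->
  0 <= J (fun t => h t - h (d + t)) 0 d + M * J (fun t => J (fun s => h (s + t)) 0 d) 0 d ->
  h d <= 2 * h 0.
Proof.
move=> ch d0 M0 Md h_ge0 h_conv energy.
have [|G [cG GE]] := @Rintegral_oo_antiderivative R h (3 * d) ch; first by lra.
have caff al be : continuous (fun x : R => h (al + be * x)).
  move=> x; apply: (@continuous_comp _ _ _ (fun x => al + be * x)); last exact: ch.
  by apply: cvgD; [exact: cvg_cst|apply: cvgMr; exact: cvg_id].
have ex (f g : R -> R) a b : (forall x, f x = g x) -> J f a b = J g a b.
  by move=> fg; apply: eq_Rintegral => x _.
pose A := G d - G 0; pose B := G (2 * d) - G d.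
have J1 : J h 0 d = A.
  transitivity (J (fun x => h (0 + 1 * x)) 0 d); first by apply: ex => x; rewrite add0r mul1r.
  by rewrite GE ?oner_eq0//; [rewrite add0r mul1r divr1| lra..].
have J2 : J (fun t => h (d + t)) 0 d = B.
  transitivity (J (fun x => h (d + 1 * x)) 0 d); first by apply: ex => x; rewrite mul1r.
  rewrite GE ?oner_eq0//; [|lra..].
  by rewrite mul1r divr1 /B (_ : d + d = 2 * d)//; ring.
have J3 : J (fun t => h (2 * t)) 0 d = (A + B) / 2.
  transitivity (J (fun x => h (0 + 2 * x)) 0 d); first by apply: ex => x; rewrite add0r.
  rewrite GE ?pnatr_eq0//; [|lra..].
  by rewrite add0r /A /B; congr (_ / _); ring.
have J3' : J (fun t => h (2 * (d - t))) 0 d = (A + B) / 2.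
  transitivity (J (fun x => h (2 * d + (- 2) * x)) 0 d); first by apply: ex => x; congr h; ring.
  rewrite GE ?oppr_eq0 ?pnatr_eq0//; [|lra..].
  by rewrite (_ : 2 * d + - 2 * d = 0) /A /B; [field|ring].
have c2 : continuous (fun t : R => h (2 * t)).
  by have := caff 0 2; under eq_fun do rewrite add0r.
have cd : continuous (fun t : R => h (d + t)).
  by have := caff d 1; under eq_fun do rewrite mul1r.
have c2' : continuous (fun t : R => h (2 * (d - t))).
  have := caff (2 * d) (- 2); rewrite (_ : (fun x => _) = (fun t => h (2 * (d - t))))//.
  by apply/funext => x; congr h; ring.
have Jc c : J (cst c) 0 d = c * d.
  by rewrite Rintegral_oo_cst ?subr0// ltW.
have cc c : continuous (cst c : R -> R) by exact: cst_continuous.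
have AB0 : 0 <= A + B.
  suff : J (cst 0) 0 d <= J (fun t => h (2 * t)) 0 d by rewrite J3 Jc; lra.
  apply: le_Rintegral_oo => // x xd; apply: h_ge0; lra.
have cM (f : R -> R) c : continuous f -> continuous (fun x : R => c * f x).
  by move=> cf x; apply: cvgMr; exact: cf.
have cD (f g : R -> R) : continuous f -> continuous g -> continuous (fun x : R => f x + g x).
  by move=> cf cg x; apply: cvgD; [exact: cf|exact: cg].
have JD (f g : R -> R) : continuous f -> continuous g ->
    J (fun x => f x + g x) 0 d = J f 0 d + J g 0 d.
  by move=> cf cg; rewrite RintegralD//; exact: integrable_oo_continuous.
have JZ (f : R -> R) c : continuous f -> J (fun x => c * f x) 0 d = c * J f 0 d.
  by move=> cf; rewrite RintegralZl//; exact: integrable_oo_continuous.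
have hA : A <= (h 0 * d + (A + B) / 2) / 2.
  have : J h 0 d <= J (fun t => 2^-1 * (cst (h 0) t + h (2 * t))) 0 d.
    apply: le_Rintegral_oo => //; first by apply: cM; exact: cD.
    move=> x xd; have := h_conv 0 x; rewrite mulr0 add0r => h1.
    by rewrite mulrC; apply: h1; lra.
  by rewrite JZ ?JD ?Jc// ?J1 ?J3; [lra|exact: cD].
have hd : h d * d <= (A + B) / 2.
  have : J (cst (h d)) 0 d <= J (fun t => 2^-1 * (h (2 * t) + h (2 * (d - t)))) 0 d.
    apply: le_Rintegral_oo => //; first by apply: cM; exact: cD.
    move=> x xd; have := h_conv x (d - x); rewrite (_ : x + (d - x) = d) => [h1|]; last by ring.
    by rewrite mulrC; apply: h1; lra.
  by rewrite JZ ?JD ?Jc// ?J3 ?J3'; [lra|exact: cD].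
have : B - A <= M * (d * (A + B) / 2).
  have inner t : 0 < t < d -> J (fun s => h (s + t)) 0 d = G (d + t) - G t.
    move=> td; transitivity (J (fun x => h (t + 1 * x)) 0 d).
      by apply: ex => x; rewrite mul1r addrC.
    by rewrite GE ?oner_eq0//; [rewrite mul1r divr1 (addrC t)|lra..].
  have cGd : continuous (fun t : R => G (d + t) + (- 1) * G t).
    apply: cD; last exact: cM.
    move=> x; apply: (@continuous_comp _ _ _ (fun x => d + x)); last exact: cG.
    by apply: cvgD; [exact: cvg_cst|exact: cvg_id].
  have le_inner t : 0 < t < d -> G (d + t) + (- 1) * G t <= (A + B) / 2 / 2 + d / 2 * h (2 * t).
    move=> td; rewrite mulN1r -inner//.
    have : J (fun s => h (s + t)) 0 d <= J (fun s => 2^-1 * (h (2 * s) + cst (h (2 * t)) s)) 0 d.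
      apply: le_Rintegral_oo => //.
      - by have := caff t 1; under eq_fun do rewrite mul1r addrC.
      - by apply: cM; exact: cD.
      - by move=> x xd; rewrite mulrC; apply: h_conv; lra.
    by rewrite JZ ?JD ?Jc// ?J3; [lra|exact: cD].
  have Jin : J (fun t => J (fun s => h (s + t)) 0 d) 0 d = J (fun t => G (d + t) + (- 1) * G t) 0 d.
    apply: eq_Rintegral => x; rewrite inE/= in_itv/= => xd.
    by rewrite inner// mulN1r.
  have Jd : J (fun t => h t - h (d + t)) 0 d = J (fun t => h t + (- 1) * h (d + t)) 0 d.
    by apply: ex => x; rewrite mulN1r.
  move: energy; rewrite Jin Jd.
  have c1 : continuous (fun t : R => (- 1) * h (d + t)) by exact: cM.
  rewrite (JD h _ ch c1) (JZ _ (- 1) cd) J1 J2.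
  have : J (fun t => G (d + t) + (- 1) * G t) 0 d <=
         J (fun t => cst ((A + B) / 2 / 2) t + d / 2 * h (2 * t)) 0 d.
    by apply: le_Rintegral_oo => //; apply: cD => //; exact: cM.
  have c5 : continuous (fun t : R => d / 2 * h (2 * t)) by exact: cM.
  rewrite (JD _ _ (cc _) c5) (JZ _ (d / 2) c2) J3 Jc.
  move: (J (fun t => G (d + t) + (- 1) * G t) 0 d) => X XAB energy.
  by have := ler_wpM2l M0 XAB; lra.
clearbody A B; clear - d0 M0 Md AB0 hA hd => hB.
have : M * (d * (A + B) / 2) <= (A + B) / 5.
  have := ler_wpM2r AB0 Md; lra.
move=> h1; rewrite -(ler_pM2r d0); lra.
Qed.

End energy_bound.

(** * The form of the equation as a kernel in two times *)

Section fractional_kernel.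
Variables (R : realType) (n : nat) (a : R).
Local Notation rV := 'rV[R]_n.+1.

Lemma frac_kernel_ge0 (x y : rV) : 0 <= frac_kernel a x y.
Proof. by rewrite /frac_kernel invr_ge0 powR_ge0. Qed.

Lemma measurable_frac_kernel :
  measurable_fun [set: rV * rV] (fun p => frac_kernel a p.1 p.2).
Proof.
have menorm : measurable_fun [set: rV * rV] (fun p => enorm (p.1 - p.2)).
  have mdot : measurable_fun [set: rV * rV] (fun p : rV * rV => dot (p.1 - p.2) (p.1 - p.2)).
    apply: measurable_sum => i.
    have mi : measurable_fun [set: rV * rV] (fun p => (p.1 - p.2) ord0 i).
      rewrite (_ : (fun p => _) = (fun p : rV * rV => rV_coord i p.1 - rV_coord i p.2)).
        apply: measurable_funB.
          exact: (measurableT_comp (measurable_rV_coord i) measurable_fst).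
        exact: (measurableT_comp (measurable_rV_coord i) measurable_snd).
      by apply/funext => p; rewrite !mxE.
    exact: measurable_funM.
  by apply: (measurableT_comp _ mdot); apply: continuous_measurable_fun; exact: sqrt_continuous.
have -> : (fun p : rV * rV => frac_kernel a p.1 p.2) =
    (fun p => enorm (p.1 - p.2) `^ (- (n.+1%:R + 2 * a))).
  by apply/funext => p; rewrite /frac_kernel powRN.
exact: (measurableT_comp (measurable_powR _) menorm).
Qed.

Lemma frac_const_ge0 : 0 <= frac_const n a.
Proof.
rewrite /frac_const invr_ge0; apply: Rintegral_ge0 => z _.
by rewrite mulr_ge0 ?frac_kernel_ge0// subr_ge0 cos_le1.
Qed.

End fractional_kernel.

Section solution_kernels.
Variables (R : realType) (n : nat) (Omega : set 'rV[R]_n.+1) (a T M : R).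
Local Notation rV := 'rV[R]_n.+1.
Local Notation mu := (leb R n.+1).
Local Notation lam := (@lebesgue_measure R).
Hypothesis mO : measurable Omega.

(** The regularity in space and time of a weak solution. *)
Definition energy_class (u : R -> rV -> R) :=
  [/\ measurable_fun (`]0, T[%classic `*` [set: rV]) (fun p => u p.1 p.2),
      (\int[lam \x mu]_(p in `]0%R, T[%classic `*` Omega) (u p.1 p.2 ^+ 2)%:E < +oo)%E,
      (\int[lam]_(t in `]0%R, T[%classic) gagliardo a (u t) < +oo)%E &
      forall t, 0 <= t <= T -> L2 Omega (u t)].

Variable u : R -> rV -> R.
Hypothesis hu : energy_class u.

(** The clauses on regularity speak of the times in ]0, T[ only. *)
Definition cut (z : R * rV) : R := \1_(`]0, T[%classic : set R) z.1 * u z.1 z.2.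

(** The two parts of the form are Gram kernels: the nonlocal part that of these
    difference quotients, and the part with a nonnegative potential [v] that of
    [weighted v]. *)
Definition difference_quotient (z : R * (rV * rV)) : R :=
  (cut (z.1, z.2.1) - cut (z.1, z.2.2)) * Num.sqrt (frac_kernel a z.2.1 z.2.2).

Definition weighted (v : rV -> R) (z : R * rV) : R :=
  cut z * (\1_Omega z.2 * Num.sqrt (v z.2)).

Lemma measurable_cut : measurable_fun [set: measurableTypeR R * rV] cut.
Proof.
have [mu_ _ _ _] := hu.
have mm : measurable_fun [set: measurableTypeR R * rV]
    ((fun p : measurableTypeR R * rV => u p.1 p.2) \_ (`]0, T[%classic `*` setT)).
  by apply/(measurable_restrictT _ _).1 => //; exact: measurableX.
have -> : cut = ((fun p : measurableTypeR R * rV => u p.1 p.2) \_ (`]0, T[%classic `*` setT)).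
  apply/funext => -[t x]; rewrite /cut /patch in_setX /= in_setT andbT indicE.
  by case: (_ \in _); rewrite ?mul1r ?mul0r.
exact: mm.
Qed.

Let cut_out s x : ~ (0 < s < T) -> cut (s, x) = 0.
Proof. by move=> nT; rewrite /cut indicE memNset ?mul0r//= in_itv. Qed.

Let cut_in s x : 0 < s < T -> cut (s, x) = u s x.
Proof. by move=> sT; rewrite /cut indicE mem_set ?mul1r//= in_itv. Qed.

Lemma square_integrable_difference_quotient :
  @square_integrable_over _ _ _ _ R lam (sprod mu mu) `]0, T[%classic difference_quotient.
Proof.
have [_ _ goo _] := hu; split.
- apply: measurable_funM.
    apply: measurable_funB; apply: (measurableT_comp measurable_cut);
      apply/measurable_fun_pairP; split => //.
    + exact: measurable_fst.
    + exact: (measurableT_comp measurable_fst measurable_snd).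
    + exact: measurable_fst.
    + exact: (measurableT_comp measurable_snd measurable_snd).
  apply: (measurableT_comp (continuous_measurable_fun (@sqrt_continuous R))).
  exact: (measurableT_comp (@measurable_frac_kernel R n a) measurable_snd).
- move=> s p; rewrite /= in_itv/= => nT.
  by rewrite /difference_quotient /= !cut_out// subrr mul0r.
apply: le_lt_trans goo; rewrite le_eqVlt; apply/orP; left; apply/eqP.
rewrite [RHS]integral_mkcond; apply: eq_integral => s _; rewrite /patch.
case: ifPn => [/set_mem|/negP sT].
  rewrite /= in_itv/= => sT; apply: eq_integral => p _; congr EFin.
  by rewrite /difference_quotient/= !cut_in// exprMn sqr_sqrtr// frac_kernel_ge0.
rewrite integral0_eq// => p _; rewrite /difference_quotient/= !cut_out ?subrr ?mul0r ?expr0n//.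
- by move=> h; apply: sT; apply/mem_set; rewrite /= in_itv.
- by move=> h; apply: sT; apply/mem_set; rewrite /= in_itv.
Qed.

Lemma square_integrable_weighted (v : rV -> R) : measurable_fun setT v -> (forall x, 0 <= v x <= 2 * M + 1) ->
  @square_integrable_over _ _ _ _ R lam mu `]0, T[%classic (weighted v).
Proof.
move=> mv v01; have [_ uoo _ _] := hu.
have mw : measurable_fun [set: measurableTypeR R * rV] (weighted v).
  apply: measurable_funM; first exact: measurable_cut.
  apply: measurable_funM; first exact: (measurableT_comp (measurable_indic mO) measurable_snd).
  apply: (measurableT_comp (continuous_measurable_fun (@sqrt_continuous R))).
  exact: (measurableT_comp mv measurable_snd).
split => //.
  by move=> s p; rewrite /= in_itv/= => nT; rewrite /weighted cut_out// mul0r.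
have mc2 : measurable_fun [set: measurableTypeR R * rV]
    (fun z => ((cut z * \1_Omega z.2) ^+ 2)%:E).
  apply/measurable_EFinP/measurable_funX/measurable_funM; first exact: measurable_cut.
  exact: (measurableT_comp (measurable_indic mO) measurable_snd).
rewrite -(fubini_tonelli1 (m1 := lam) (m2 := mu) (fun z => (weighted v z ^+ 2)%:E)); last 2 first.
- by apply/measurable_EFinP; exact: measurable_funX.
- by move=> z; rewrite lee_fin sqr_ge0.
apply: (@le_lt_trans _ _ (\int[lam \x mu]_z ((2 * M + 1)%:E * ((cut z * \1_Omega z.2) ^+ 2)%:E))%E).
  apply: ge0_le_integral => //.
  - by move=> z _; rewrite lee_fin sqr_ge0.
  - by apply/measurable_EFinP; exact: measurable_funX.
  - exact: measurable_funeM.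
  move=> z _; rewrite -EFinM lee_fin /weighted mulrA exprMn sqr_sqrtr; last by have := v01 z.2; lra.
  by rewrite mulrC ler_wpM2r ?sqr_ge0//; have := v01 z.2; lra.
have M1 : (0 <= (2 * M + 1)%:E)%E by rewrite lee_fin; have := v01 0; lra.
rewrite ge0_integralZl//; last by move=> z _; rewrite lee_fin sqr_ge0.
rewrite lte_mul_pinfty//.
apply: le_lt_trans uoo; rewrite le_eqVlt; apply/orP; left; apply/eqP.
rewrite [RHS]integral_mkcond; apply: eq_integral => -[s x] _; rewrite /patch /=.
rewrite in_setX/= /cut/= !indicE; case: (s \in _); case: (x \in _) => /=;
  by rewrite ?mul1r ?mulr1 ?mul0r ?mulr0 ?expr0n.
Qed.

End solution_kernels.

Section form_kernel.
Variables (R : realType) (n : nat) (Omega : set 'rV[R]_n.+1) (a T M : R).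
Variable q : 'rV[R]_n.+1 -> R.
Local Notation rV := 'rV[R]_n.+1.
Local Notation mu := (leb R n.+1).
Local Notation lam := (@lebesgue_measure R).
Hypotheses (mO : measurable Omega) (mq : measurable_fun setT q) (qM : forall x, `|q x| <= M).
Hypothesis (M0 : 0 <= M).

Definition energy_form (u v : rV -> R) : R :=
  frac_form a u v + \int[mu]_(x in Omega) (q x * u x * v x).

Lemma energy_formC u v : energy_form u v = energy_form v u.
Proof.
rewrite /energy_form /frac_form; congr (_ * _ + _).
  by apply: eq_Rintegral => p _; congr (_ * _); rewrite mulrC.
by apply: eq_Rintegral => x _; rewrite mulrAC.
Qed.

Variables u w : R -> rV -> R.
Hypotheses (hu : energy_class Omega a T u) (hw : energy_class Omega a T w).

Let gram_diff := gram (sprod mu mu) (difference_quotient a T u) (difference_quotient a T w).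
Let gram_w (v : rV -> R) := gram mu (weighted Omega T u v) (weighted Omega T w v).

Let gram_diffE s t : 0 < s < T -> 0 < t < T ->
  frac_form a (u s) (w t) = frac_const n a / 2 * gram_diff (s, t).
Proof.
move=> sT tT; rewrite /frac_form; congr (_ * _).
apply: eq_Rintegral => p _; rewrite /difference_quotient/= /cut/=.
rewrite !indicE !mem_set/= ?in_itv//= !mul1r.
have -> (x y k : R) : x * k * (y * k) = x * y * k ^+ 2 by ring.
by rewrite sqr_sqrtr// frac_kernel_ge0.
Qed.

Let gram_wE (v : rV -> R) s t : (forall x, 0 <= v x) -> 0 < s < T -> 0 < t < T ->
  gram_w v (s, t) = \int[mu]_(x in Omega) (v x * u s x * w t x).
Proof.
move=> v0 sT tT; rewrite [RHS]Rintegral_mkcond; apply: eq_Rintegral => x _.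
rewrite /weighted/= /cut/= !indicE (mem_set (_ : `]0, T[%classic s)) ?(mem_set (_ : `]0, T[%classic t))/= ?in_itv//=.
rewrite !mul1r /patch; case: (x \in Omega); last by rewrite !mul0r !mulr0.
rewrite !mul1r.
have -> (z y k : R) : z * k * (y * k) = k ^+ 2 * z * y by ring.
by rewrite sqr_sqrtr.
Qed.

Let qM0 x : 0 <= q x + M <= 2 * M + 1.
Proof. by have := qM x; rewrite ler_norml; lra. Qed.

Let formE s t : 0 < s < T -> 0 < t < T -> energy_form (u s) (w t) =
  frac_const n a / 2 * gram_diff (s, t) + gram_w (fun x => q x + M) (s, t)
    - M * gram_w (fun=> 1) (s, t).
Proof.
move=> sT tT; rewrite /energy_form gram_diffE// -addrA; congr (_ + _).
rewrite !gram_wE//; last by move=> x; have /andP[] := qM0 x.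
have [[_ _ _ Lu] [_ _ _ Lw]] := (hu, hw).
have Ls : L2 Omega (u s) by apply: Lu; lra.
have Lt : L2 Omega (w t) by apply: Lw; lra.
have iuw := L2_integrable_mul mO Ls Lt.
have iM : mu.-integrable Omega (EFin \o (fun x => M * (1 * u s x * w t x))).
  have := integrableZl mO M iuw; apply: eq_integrable => // x _ /=.
  by rewrite -EFinM mul1r.
have i1 : mu.-integrable Omega (EFin \o (fun x => 1 * u s x * w t x)).
  by move: iuw; apply: eq_integrable => // x _ /=; rewrite mul1r.
have mu_ : measurable_fun Omega (u s) by case: Ls.
have mw_ : measurable_fun Omega (w t) by case: Lt.
have iq : mu.-integrable Omega (EFin \o (fun x => q x * u s x * w t x)).
  apply: le_integrable iM => //.
    apply/measurable_EFinP; apply: measurable_funM => //; apply: measurable_funM => //.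
    exact: measurable_funTS.
  move=> x _ /=; rewrite lee_fin mul1r -mulrA !normrM ler_wpM2r//.
  by rewrite (ger0_norm M0).
rewrite -RintegralZl// -RintegralB//; last first.
  move: (integrableD mO iq iM); apply: eq_integrable => // x _ /=.
  by rewrite -EFinD; congr EFin; ring.
by apply: eq_Rintegral => x _; ring.
Qed.

Let ip_gram s t : 0 < s < T -> 0 < t < T -> ip Omega (u s) (w t) = gram_w (fun=> 1) (s, t).
Proof. by move=> sT tT; rewrite gram_wE//; apply: eq_Rintegral => x _; rewrite mul1r. Qed.

Let itvoo (b : R) : (lam (`]0%R, b[%classic : set R) < +oo)%E.
Proof. by rewrite lebesgue_measure_itv/=; case: ifPn => // _; rewrite -EFinB ltry. Qed.

Let lam2 := (lam \x lam)%E.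

Let sqw (v : rV -> R) (hv : measurable_fun setT v) (v0 : forall x, 0 <= v x <= 2 * M + 1) :=
  (square_integrable_weighted mO hu hv v0, square_integrable_weighted mO hw hv v0).

Let mqM : measurable_fun setT (fun x => q x + M).
Proof. exact: measurable_funD. Qed.

Let m1 : measurable_fun setT (fun _ : rV => 1 : R).
Proof. exact: measurable_cst. Qed.

Let M1 (x : rV) : 0 <= (1 : R) <= 2 * M + 1.
Proof. by rewrite ler01 lerDr mulr_ge0. Qed.

Let i_diff b c : lam2.-integrable (`]0, b[%classic `*` `]0, c[%classic) (EFin \o gram_diff).
Proof.
apply: (integrable_gram_rect (square_integrable_difference_quotient hu)
  (square_integrable_difference_quotient hw)) => //; exact: itvoo.
Qed.

Let i_w (v : rV -> R) (hv : measurable_fun setT v) (v0 : forall x, 0 <= v x <= 2 * M + 1) b c :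
  lam2.-integrable (`]0, b[%classic `*` `]0, c[%classic) (EFin \o gram_w v).
Proof.
have [h1 h2] := sqw hv v0.
by apply: (integrable_gram_rect h1 h2) => //; exact: itvoo.
Qed.

Let mrect (b c : R) : measurable (`]0, b[%classic `*` `]0, c[%classic : set (measurableTypeR R * measurableTypeR R)).
Proof. exact: measurableX. Qed.

Lemma integrable_form b c : b <= T -> c <= T ->
  lam2.-integrable (`]0, b[%classic `*` `]0, c[%classic)
    (EFin \o (fun z => energy_form (u z.1) (w z.2))).
Proof.
move=> bT cT.
have i := integrableB (mrect b c) (integrableD (mrect b c)
  (integrableZl (mrect b c) (frac_const n a / 2) (i_diff b c)) (i_w mqM qM0 b c))
  (integrableZl (mrect b c) M (i_w m1 M1 b c)).
move: i; apply: eq_integrable => // -[s t] /set_mem[]/=; rewrite !in_itv/= => sb tc.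
by rewrite /= formE//; lra.
Qed.

Lemma form_swap b c : b <= T -> c <= T ->
  \int[lam]_(t in `]0, c[) \int[lam]_(s in `]0, b[) energy_form (u s) (w t) =
  \int[lam]_(s in `]0, b[) \int[lam]_(t in `]0, c[) energy_form (u s) (w t).
Proof.
move=> bT cT; have i := integrable_form bT cT.
transitivity (\int[lam2]_(z in `]0, b[%classic `*` `]0, c[%classic) energy_form (u z.1) (w z.2)).
  exact: (Rintegral_fubini_rect2 _ _ i).
by apply/esym; exact: (Rintegral_fubini_rect _ _ i).
Qed.

Lemma ip_fubini b : b <= T ->
  \int[lam]_(t in `]0, b[) \int[lam]_(s in `]0, b[) ip Omega (u s) (w t) =
  \int[lam2]_(z in `]0, b[%classic `*` `]0, b[%classic) gram_w (fun=> 1) z.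
Proof.
move=> bT; transitivity (\int[lam]_(t in `]0, b[) \int[lam]_(s in `]0, b[) gram_w (fun=> 1) (s, t)).
  2: exact: (Rintegral_fubini_rect2 _ _ (i_w m1 M1 b b)).
apply: eq_Rintegral => t; rewrite inE/= in_itv/= => tb.
apply: eq_Rintegral => s; rewrite inE/= in_itv/= => sb.
by rewrite ip_gram//; lra.
Qed.

Lemma form_fubini b : b <= T ->
  \int[lam]_(t in `]0, b[) \int[lam]_(s in `]0, b[) energy_form (u s) (w t) =
  \int[lam2]_(z in `]0, b[%classic `*` `]0, b[%classic)
    (frac_const n a / 2 * gram_diff z + gram_w (fun x => q x + M) z - M * gram_w (fun=> 1) z).
Proof.
move=> bT; transitivity (\int[lam2]_(z in `]0, b[%classic `*` `]0, b[%classic) energy_form (u z.1) (w z.2)).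
  exact: (Rintegral_fubini_rect2 _ _ (integrable_form bT bT)).
apply: eq_Rintegral => -[s t] /set_mem[]/=; rewrite !in_itv/= => sb tb.
by rewrite formE//; lra.
Qed.

(** After adding [M] times the scalar products, the kernel of the form is a
    sum of Gram kernels when the two solutions coincide, hence positive. *)
Lemma form_energy b : u = w -> b <= T ->
  0 <= \int[lam]_(t in `]0, b[) \int[lam]_(s in `]0, b[) energy_form (u s) (w t) +
     M * \int[lam]_(t in `]0, b[) \int[lam]_(s in `]0, b[) ip Omega (u s) (w t).
Proof.
move=> uw bT; rewrite form_fubini// ip_fubini//.
have i1 := i_diff b b; have i2 := i_w mqM qM0 b b; have i3 := i_w m1 M1 b b.
have := mrect b b; move: i1 i2 i3; set D := (_ `*` _) => i1 i2 i3 mD.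
have ic1 : lam2.-integrable D (EFin \o (fun z => frac_const n a / 2 * gram_diff z)).
  by have := integrableZl mD (frac_const n a / 2) i1; apply: eq_integrable.
have ic3 : lam2.-integrable D (EFin \o (fun z => M * gram_w (fun=> 1) z)).
  by have := integrableZl mD M i3; apply: eq_integrable.
have i12 : lam2.-integrable D (EFin \o (fun z => frac_const n a / 2 * gram_diff z + gram_w (fun x => q x + M) z)).
  by have := integrableD mD ic1 i2; apply: eq_integrable.
rewrite RintegralB// RintegralD// !RintegralZl// subrK.
have h1 : 0 <= \int[lam2]_(z in D) gram_diff z.
  by rewrite /gram_diff -uw; apply: (gram_rect_ge0 (square_integrable_difference_quotient hu)) => //; exact: itvoo.
have h2 : 0 <= \int[lam2]_(z in D) gram_w (fun x => q x + M) z.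
  have [h2 _] := sqw mqM qM0.
  by rewrite /gram_w -uw; apply: (gram_rect_ge0 h2) => //; exact: itvoo.
by rewrite addr_ge0// mulr_ge0// divr_ge0// frac_const_ge0.
Qed.

End form_kernel.

(** * Weak solutions form a symmetric semigroup *)

Section weak_solutions.
Variables (R : realType) (n : nat) (Omega : set 'rV[R]_n.+1) (a T M : R).
Variable q : 'rV[R]_n.+1 -> R.
Local Notation rV := 'rV[R]_n.+1.
Local Notation mu := (leb R n.+1).
Local Notation lam := (@lebesgue_measure R).
Local Notation J g a b := (\int[lam]_(x in `]a, b[) g x).
Hypotheses (mO : measurable Omega) (mq : measurable_fun setT q) (qM : forall x, `|q x| <= M).
Hypotheses (M0 : 0 <= M) (T0 : 0 < T).
Implicit Types (f g : rV -> R) (u w : R -> rV -> R).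
Local Notation ip := (ip Omega).
Local Notation form := (energy_form Omega a q).

Lemma weak_solution_energy_class f u : weak_solution Omega a T q f u ->
  energy_class Omega a T u.
Proof. by case=> -[? ?] _ Lu [_ ?] _; split => // t tT; have [] := Lu t tT. Qed.

Lemma weak_solution_initial f u : weak_solution Omega a T q f u ->
  {ae mu, forall x, Omega x -> u 0 x = f x}.
Proof. by case=> _ []. Qed.

Lemma weak_solution_initial_L2 f u : weak_solution Omega a T q f u ->
  measurable_fun Omega f -> L2 Omega f.
Proof.
move=> wu mf; have [_ _ _ Lu] := weak_solution_energy_class wu.
have [|m0 s0] := (L2P Omega (u 0)).1; first by apply: Lu; have := T0; lra.
apply/L2P; split => //; apply: le_lt_trans s0; rewrite le_eqVlt; apply/orP; left; apply/eqP.
apply: ge0_ae_eq_integral => //.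
- by apply/measurable_EFinP; exact: measurable_funX.
- by apply/measurable_EFinP; exact: measurable_funX.
- by move=> x _; rewrite lee_fin sqr_ge0.
- by move=> x _; rewrite lee_fin sqr_ge0.
by apply: filterS (weak_solution_initial wu) => x h Ox; rewrite h.
Qed.

(** Almost every time of a solution lies in the energy space, so it may serve as
    a test function in the equation for another solution. *)
Lemma weak_solution_tested f u w t s : weak_solution Omega a T q f u ->
  energy_space a Omega (w t) -> L2 Omega (w t) -> 0 <= s <= T ->
  J (fun r => form (u r) (w t)) 0 s = ip (u 0) (w t) - ip (u s) (w t).
Proof.
move=> wu wt Lw sT; have := wu; case=> _ _ _ _ W.
have h0 := W _ wt 0; have hs := W _ wt s sT.
have {}h0 : ip (u 0) (w t) = \int[mu]_(x in Omega) (f x * w t x).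
  by rewrite -h0; [rewrite set_itvoo0 Rintegral_set0 addr0|lra].
by rewrite h0 -hs addrC addKr.
Qed.

(** Times are clamped to [0, T], so that functions of time live on the whole line. *)
Let cl (t : R) : R := Num.max 0 (Num.min T t).

Let cl_in t : 0 <= cl t <= T.
Proof. by rewrite /cl le_max lexx/= ge_max ge_min lexx/= ltW. Qed.

Let cl_id t : 0 <= t <= T -> cl t = t.
Proof. by move=> /andP[t0 tT]; rewrite /cl min_r// max_r. Qed.

Let cl_continuous : continuous cl.
Proof.
move=> t; apply: (@continuous_max R R (cst 0)); first exact: cst_continuous.
by apply: (@continuous_min R R (cst T)); [exact: cst_continuous|exact: cvg_id].
Qed.

Let dist u s t := fine (L2norm Omega (u s - u t)).

Let dist_cvg f u t : weak_solution Omega a T q f u ->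
  dist u (cl s) (cl t) @[s --> t] --> 0.
Proof.
move=> wu; have := wu; case=> _ _ Lu _ _.
have [_ /fine_cvgP[_ h]] := Lu _ (cl_in t).
have clw : cl @ t --> within `[0, T]%classic (nbhs (cl t)).
  move=> P /= hP; have := cl_continuous hP; rewrite /= !near_simpl => hP'.
  near=> s; have : `[0, T]%classic (cl s) -> P (cl s) by near: s; exact: hP'.
  by apply; rewrite /= in_itv/=.
exact: (cvg_comp _ _ clw h).
Unshelve. all: by end_near. Qed.

Let ipBl (f g k : rV -> R) : L2 Omega f -> L2 Omega g -> L2 Omega k ->
  ip (f - g) k = ip f k - ip g k.
Proof.
by move=> Lf Lg Lk; rewrite addrC -scaleN1r ip_linear// mulN1r addrC.
Qed.

Let pairing u w (s t : R) := ip (u (cl s)) (w (cl t)).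

Let pairing_continuous f g u w : weak_solution Omega a T q f u ->
  weak_solution Omega a T q g w ->
  continuous (fun p : R * R => pairing u w p.1 p.2).
Proof.
move=> wu ww [s0 t0].
have [_ _ _ Lu] := weak_solution_energy_class wu.
have [_ _ _ Lw] := weak_solution_energy_class ww.
pose A s := dist u (cl s) (cl s0); pose C t := dist w (cl t) (cl t0).
pose B := fine (L2norm Omega (w (cl t0))); pose D := fine (L2norm Omega (u (cl s0))).
have bound p : `|pairing u w s0 t0 - pairing u w p.1 p.2| <= A p.1 * C p.2 + A p.1 * B + D * C p.2.
  have Lus := Lu _ (cl_in p.1); have Lu0 := Lu _ (cl_in s0).
  have Lwt := Lw _ (cl_in p.2); have Lw0 := Lw _ (cl_in t0).
  have Ldu := L2B mO Lus Lu0; have Ldw := L2B mO Lwt Lw0.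
  have -> : pairing u w s0 t0 - pairing u w p.1 p.2 =
     - (ip (u (cl p.1) - u (cl s0)) (w (cl p.2) - w (cl t0)) +
        ip (u (cl p.1) - u (cl s0)) (w (cl t0)) +
        ip (u (cl s0)) (w (cl p.2) - w (cl t0))).
    rewrite (ipBl _ _ Ldw)// (ipBl _ _ Lw0)// !(ipC _ _ (w (cl p.2) - _)) !ipBl//.
    by rewrite /pairing !(ipC _ (w _)); ring.
  rewrite normrN; apply: (le_trans (ler_normD _ _)); apply: lerD; last exact: cauchy_schwarz_ip.
  by apply: (le_trans (ler_normD _ _)); apply: lerD; exact: cauchy_schwarz_ip.
have cA : A p.1 @[p --> (s0, t0)] --> 0.
  by apply: (cvg_comp fst A); [exact: cvg_fst|exact: (dist_cvg s0 wu)].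
have cC : C p.2 @[p --> (s0, t0)] --> 0.
  by apply: (cvg_comp snd C); [exact: cvg_snd|exact: (dist_cvg t0 ww)].
have cbound : A p.1 * C p.2 + A p.1 * B + D * C p.2 @[p --> (s0, t0)] --> 0.
  rewrite [X in _ --> X](_ : 0 = 0 * 0 + 0 * B + D * 0); last by rewrite !mul0r mulr0 !addr0.
  apply: cvgD; last by apply: cvgM => //; exact: cvg_cst.
  by apply: cvgD; apply: cvgM => //; exact: cvg_cst.
apply/cvgrPdist_le => e e0.
move/cvgrPdist_le : cbound => /(_ _ e0) cbound.
near=> p; apply: (le_trans (bound p)).
have : `|0 - (A p.1 * C p.2 + A p.1 * B + D * C p.2)| <= e by near: p.
by rewrite sub0r normrN; apply: le_trans; exact: ler_norm.
Unshelve. all: by end_near. Qed.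

(** [weak_solution_tested] holds for almost every time of [w] only; an integral
    over these times does not see the exceptions. *)
Let tested_in_time f g u w s t : weak_solution Omega a T q f u ->
  weak_solution Omega a T q g w -> 0 <= s <= T -> 0 <= t <= T ->
  J (fun r => pairing u w 0 r - pairing u w s r) 0 t =
  J (fun r => J (fun r' => form (u r') (w r)) 0 s) 0 t.
Proof.
move=> wu ww sT tT.
have hu := weak_solution_energy_class wu; have hw := weak_solution_energy_class ww.
have sT' : s <= T by lra.
have tT' : t <= T by lra.
have cp := pairing_continuous wu ww.
have cp1 r0 : continuous (pairing u w r0).
  by move=> r; apply: continuous2_cvg; [exact: (@cp (r0, r))|exact: cvg_cst|exact: cvg_id].
congr fine; apply: ae_eq_integral => //.
- apply/measurable_EFinP; apply: measurable_funTS; apply: continuous_measurable_fun.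
  by move=> r; apply: cvgB; exact: cp1.
- apply/measurable_EFinP.
  exact: (measurable_Rintegral_rect2 _ _ (integrable_form mO mq qM M0 hu hw sT' tT')).
have [_ _ Lw [ae _] _] := ww.
apply: (@filterS _ _ (ae_filter_ringOfSetsType lam)) ae => r er; rewrite /= in_itv/= => rt.
have rT : 0 <= r <= T by lra.
rewrite (weak_solution_tested wu)//; last 2 first.
- by apply: er; lra.
- by have [] := Lw r rT.
by rewrite /pairing !cl_id//; rewrite lexx ltW.
Qed.

(** Both sides of the closedness condition are integrals of the form over the
    same rectangle of times: Fubini's theorem and the symmetry of the form. *)
Let pairing_sum f g u w s t : weak_solution Omega a T q f u ->
  weak_solution Omega a T q g w -> 0 <= s -> 0 <= t -> s + t <= T ->
  pairing u w s t = pairing u w (s + t) 0.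
Proof.
move=> wu ww; apply: (function_of_sum (pairing_continuous wu ww)) => {}s {}t sT tT.
have hu := weak_solution_energy_class wu; have hw := weak_solution_energy_class ww.
have sT' : s <= T by lra.
have tT' : t <= T by lra.
rewrite (tested_in_time wu ww sT tT) (form_swap mO mq qM M0 hu hw sT' tT').
transitivity (J (fun r => pairing w u 0 r - pairing w u t r) 0 s).
  rewrite (tested_in_time ww wu tT sT); apply: eq_Rintegral => r _.
  by apply: eq_Rintegral => r' _; exact: energy_formC.
by apply: eq_Rintegral => r _; rewrite /pairing !(ipC _ (w _)).
Qed.

Let pairing_id u w s t : 0 <= s <= T -> 0 <= t <= T -> pairing u w s t = ip (u s) (w t).
Proof. by move=> sT tT; rewrite /pairing !cl_id. Qed.

Let ip_initial f u k : weak_solution Omega a T q f u -> measurable_fun Omega f ->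
  L2 Omega k -> ip k (u 0) = ip k f.
Proof.
move=> wu mf Lk; have [_ _ _ Lu] := weak_solution_energy_class wu.
rewrite ipC (ip_ae_l mO _ _ Lk (weak_solution_initial wu)) 1?ipC//.
- by apply: Lu; rewrite lexx ltW.
- exact: (weak_solution_initial_L2 wu).
Qed.

Lemma weak_solution_semigroup f g u w s t : weak_solution Omega a T q f u ->
  weak_solution Omega a T q g w -> measurable_fun Omega g ->
  0 <= s -> 0 <= t -> s + t <= T -> ip (u s) (w t) = ip (u (s + t)) g.
Proof.
move=> wu ww mg s0 t0 stT; have [_ _ _ Lu] := weak_solution_energy_class wu.
rewrite -(ip_initial ww mg); last by apply: Lu; lra.
by have := pairing_sum wu ww s0 t0 stT; rewrite !pairing_id//; have := T0; lra.
Qed.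

Lemma weak_solution_symmetric f g u w t : weak_solution Omega a T q f u ->
  weak_solution Omega a T q g w -> measurable_fun Omega f -> measurable_fun Omega g ->
  0 <= t <= T -> ip (u t) g = ip f (w t).
Proof.
move=> wu ww mf mg tT; have [_ _ _ Lw] := weak_solution_energy_class ww.
have [t0 tT'] : 0 <= t /\ 0 + t <= T by rewrite add0r; exact/andP.
have := weak_solution_semigroup wu ww mg (lexx 0) t0 tT'; rewrite add0r => <-.
by rewrite ipC (ip_initial wu mf) 1?ipC//; exact: Lw.
Qed.

(** [h (s + t)] is the product of [u s] and [u t], so the convexity of [h] is
    the positivity of the squared norm of [u s - u t]. *)
Lemma weak_solution_short_time f u t : weak_solution Omega a T q f u ->
  measurable_fun Omega f -> 0 < t -> 4 * t <= T -> M * (2 * t) <= 2 / 5 ->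
  ip (u t) (u t) <= 2 * ip f f.
Proof.
move=> wu mf t0 tT Mt; have hu := weak_solution_energy_class wu.
have [_ _ _ Lu] := hu; have Lf := weak_solution_initial_L2 wu mf.
have T0' : 0 <= (0 : R) <= T by rewrite lexx ltW.
pose h r := pairing u u r 0.
have hD r s : 0 <= r -> 0 <= s -> r + s <= T -> h (r + s) = ip (u r) (u s).
  move=> r0 s0 rsT; rewrite /h -(pairing_sum wu wu r0 s0 rsT) pairing_id//; lra.
have h0 : h 0 = ip f f.
  by rewrite /h pairing_id// (ip_initial wu mf) 1?ipC ?(ip_initial wu mf)//; exact: Lu.
have ht : h (2 * t) = ip (u t) (u t) by rewrite mulrDl mul1r hD//; lra.
have ch : continuous h.
  move=> r; apply: continuous2_cvg; [exact: (@pairing_continuous _ _ _ _ wu wu (r, 0))|exact: cvg_id|exact: cvg_cst].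
rewrite -ht -h0; apply: (short_time_bound ch _ M0 Mt).
- lra.
- by move=> r rt; rewrite mulrDl mul1r hD ?ip_ge0//; lra.
- move=> r s rt st; rewrite !(mulrDl 1 1) !mul1r !hD; try lra.
  have Lr : L2 Omega (u r) by apply: Lu; lra.
  have Ls : L2 Omega (u s) by apply: Lu; lra.
  have := ip_ge0 Omega (u r - u s).
  rewrite (ipBl _ _ (L2B mO Lr Ls))// !(ipC _ _ (u r - u s)) !ipBl//.
  by rewrite (ipC _ (u s) (u r)); lra.
have d2T : 2 * t <= T by lra.
have eqs (x x' y y' : R) : x = x' -> y = y' -> 0 <= x + M * y -> 0 <= x' + M * y'.
  by move=> -> ->.
have d2 : 0 <= 2 * t <= T by lra.
apply: (eqs _ _ _ _ _ _ (form_energy mO mq qM M0 hu hu erefl d2T)).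
  rewrite -(tested_in_time wu wu d2 d2).
  apply: eq_Rintegral => r; rewrite inE/= in_itv/= => rt.
  rewrite /h -(pairing_sum wu wu); [|lra..].
  by rewrite /pairing (ipC _ (u (cl 0))).
apply: eq_Rintegral => r; rewrite inE/= in_itv/= => rt.
apply: eq_Rintegral => s; rewrite inE/= in_itv/= => st.
by rewrite hD//; lra.
Qed.

Lemma weak_solution_initial_limit f u e : weak_solution Omega a T q f u ->
  measurable_fun Omega f -> 0 < e ->
  exists2 d, 0 < d & forall t, 0 < t < d -> t <= T -> ip (u t - f) (u t - f) < e.
Proof.
move=> wu mf e0; have [_ _ _ Lu] := weak_solution_energy_class wu.
have T0' : 0 <= (0 : R) <= T by rewrite lexx ltW.
have Lf := weak_solution_initial_L2 wu mf.
have [_ _ Lc _ _] := wu; have [_ /fine_cvgP[_ /cvgrPdist_lt h]] := Lc 0 T0'.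
have se : 0 < Num.min 1 e by rewrite lt_min ltr01.
have [d /= d0 hd] := h _ se; exists d => // t td tT.
have tT' : 0 <= t <= T by lra.
have : dist u t 0 < Num.min 1 e.
  have := hd t; rewrite /= sub0r normrN sub0r normrN.
  rewrite gtr0_norm; last by case/andP: td.
  move=> H; apply: le_lt_trans (ler_norm _) (H _ _); first by case/andP: td.
  by rewrite in_itv.
have Lu0 := Lu _ T0'; have Lut := Lu _ tT'.
have -> : ip (u t - f) (u t - f) = ip (u t - u 0) (u t - u 0).
  have e1 := ip_initial wu mf Lut; have e2 := ip_initial wu mf Lf.
  have e3 := ip_initial wu mf Lu0.
  rewrite (ipBl _ _ (L2B mO Lut Lf))// (ipBl _ _ (L2B mO Lut Lu0))//.
  rewrite !(ipC _ _ (u t - _)) !ipBl// !(ipC _ _ (u t)) e1 e3.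
  by rewrite (ipC _ (u 0)) e2.
rewrite ip_L2norm//; last exact: L2B.
have : 0 <= dist u t 0 by rewrite fine_ge0// Lnorm_ge0.
rewrite lt_min /dist; set z := fine _; nra.
Qed.

End weak_solutions.

Theorem theorem2 (R : realType) (n : nat) (Omega : set 'rV[R]_n.+1) (a T : R)
    (q : 'rV[R]_n.+1 -> R)
    (u : ('rV[R]_n.+1 -> R) -> R -> 'rV[R]_n.+1 -> R)
    (hOmega : bounded_C11_domain Omega)
    (ha : 1 / 2 < a < 1) (hT : 0 < T)
    (hq : Cc_infty Omega q)
    (hq0 : zero_not_eigenvalue Omega a T q)
    (hu : forall f, Cc_infty Omega f -> weak_solution Omega a T q f (u f))
    (Ttilde : R) (hTtilde : 0 < Ttilde <= T) :
  dense_in_L2 Omega [set u f Ttilde | f in Cc_infty Omega].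
Proof.
have [oO _ _ bO _] := hOmega.
have mO : measurable Omega := open_measurable_rV oO.
have mD f : Cc_infty Omega f -> measurable_fun setT f.
  by move=> Df; exact: continuous_measurable_rV (Cc_infty_continuous Df).
have mDO f : Cc_infty Omega f -> measurable_fun Omega f.
  by move=> Df; exact: measurable_funTS (mD f Df).
have mq := mD q hq; have [M M0 qM] := Cc_infty_bounded hq.
have DL2 f : Cc_infty Omega f -> L2 Omega f.
  by move=> Df; exact: (weak_solution_initial_L2 mO hT (hu f Df) (mDO f Df)).
have uL2 t f : 0 <= t <= T -> Cc_infty Omega f -> L2 Omega (u f t).
  by move=> tT Df; have [_ _ _ L] := weak_solution_energy_class (hu f Df); exact: L.
have tT' : 0 <= Ttilde <= T by lra.
split; first by move=> _ [f Df <-]; exact: uL2.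
move=> g Lg eps eps0.
have [||||||f Df fg] := @dense_range_semigroup R ('rV[R]_n.+1 -> R)
  (L2 Omega) (Cc_infty Omega) (ip Omega) DL2 (@L2_linear _ _ _ mO) _ (Cc_infty0 Omega)
  (fun f g _ _ => ipC Omega f g) (@ip_linear _ _ _ mO) (fun f _ => ip_ge0 Omega f) _
  (fun t f => u f t) T uL2 _ _ _ _ Ttilde hTtilde g Lg (eps ^+ 2) (exprn_gt0 2 eps0).
- by move=> c f k Df Dk; apply: Cc_infty_add => //; exact: Cc_inftyZ.
- move=> k Lk e e0; have [mk k2] := (L2P Omega k).1 Lk.
  have e20 : 0 < e / 2 by lra.
  have [f Df fk] := Cc_infty_dense_square oO bO mk k2 e20; exists f => //.
  have : ((ip Omega (f - k) (f - k))%:E <= (e / 2)%:E)%E.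
    by rewrite ip_sqint//; apply: L2B => //; exact: DL2.
  by rewrite lee_fin; lra.
- move=> s t f k s0 t0 stT Df Dk.
  exact: (weak_solution_semigroup mO mq qM M0 hT (hu f Df) (hu k Dk) (mDO k Dk)).
- move=> t f k tT Df Dk.
  exact: (weak_solution_symmetric mO mq qM M0 hT (hu f Df) (hu k Dk) (mDO f Df) (mDO k Dk)).
- have M1 : 0 < M + 1 by lra.
  exists (Num.min (T / 4) (5 * (M + 1))^-1), 2; split => //.
    by rewrite lt_min divr_gt0//= invr_gt0 mulr_gt0.
  move=> t f; rewrite le_min => /andP[t0 /andP[t4 tM]] _ Df.
  apply: (weak_solution_short_time mO mq qM M0 hT (hu f Df) (mDO f Df) t0); first by lra.
  have : t * (5 * (M + 1)) <= 1 by rewrite -ler_pdivlMr ?mulr_gt0// div1r.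
  have := t0; nra.
- by move=> f e Df e0; exact: (weak_solution_initial_limit mO hT (hu f Df) (mDO f Df) e0).
exists (u f Ttilde); first by exists f.
by apply: (L2norm_lt mO) => //; apply: (L2B mO) => //; exact: uL2.
Qed.
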